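(* Let $M\in\mathcal{W}_k(d)$ be $2$-neighbourly. Then the $g$-vector $(g_0,\dots,g_{d+1})$ of $M$ is related to its Betti numbers $\beta_i=\dim_{\mathbb F}H_i(M;\mathbb F)$ (with respect to an arbitrary field $\mathbb F$) as follows: (a) if $d=2k$, then $\displaystyle g_{l+1}\ge\binom{d+2}{l+1}\sum_{i=1}^{l}(-1)^{l-i}\beta_i$ for $1\le l\le k-1$; (b) if $d\ge2k+1$, then $\displaystyle g_{l+1}\ge\binom{d+2}{l+1}\sum_{i=1}^{l}(-1)^{l-i}\beta_i$ for $1\le l\le k$; (c) if $d\ge 2k+2$, then $\displaystyle g_{l+1}=\binom{d+2}{l+1}\sum_{i=1}^{l}(-1)^{l-i}\beta_i$ for $k\le l\le d-k-1$; and (d) if $d\ge2k+2$, then $\beta_i=0$ for $k+1\le i\le d-k-1$.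
   Context: All simplicial complexes are finite and abstract, and the empty set is a face of each; isomorphic complexes are identified. For a finite set $\alpha$, $\overline\alpha$ is the complex of all subsets of $\alpha$ and $\partial\alpha$ the complex of all proper subsets of $\alpha$; $X*Y$ denotes the join. If $X$ is a $d$-dimensional complex and $\overline\alpha*\partial\beta$ ($\alpha,\beta\ne\emptyset$ disjoint, $\dim\alpha+\dim\beta=d$, where $\dim\alpha=\#(\alpha)-1$) is the induced subcomplex of $X$ on $\alpha\sqcup\beta$ (if $\beta$ is a single element this means that $\alpha\in X$ and $\beta$ is a new vertex not in $X$), then $Y=(X\setminus(\overline\alpha*\partial\beta))\cup(\partial\alpha*\overline\beta)$ is said to be obtained from $X$ by the bistellar move $\alpha\mapsto\beta$, of index $\dim\beta$. $S^{d}_{d+2}$ denotes the standard $d$-sphere, i.e. $\partial\gamma$ with $\#(\gamma)=d+2$. For $0\le k\le d+1$, a $d$-dimensional complex is $k$-stellated if it can be obtained from $S^d_{d+2}$ by a finite sequence of bistellar moves, each of index $<k$ (so $S^d_{d+2}$ is the only $0$-stellated one); such complexes are triangulated spheres. The link of a vertex $x$ is $\mathrm{lk}_X(x)=\{\alpha\in X: x\notin\alpha,\ \alpha\cup\{x\}\in X\}$. For $0\le k\le d$, $\mathcal W_k(d)$ is the class of connected simplicial complexes of dimension $d$ all of whose vertex links are $k$-stellated $(d-1)$-spheres. A complex is $2$-neighbourly if any two of its vertices form a face. For a $d$-dimensional complex $X$, $f_i$ is the number of $i$-dimensional faces ($f_{-1}=1$) and $$g_j(X)=\sum_{i=-1}^{j-1}(-1)^{j-i-1}\binom{d-i+1}{j-i-1}f_i(X),\quad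 0\le j\le d+1.$$ *)

(* Defs.v *)
From HB Require Import structures.
From mathcomp Require Import all_boot all_order all_algebra.

Set Implicit Arguments.
Unset Strict Implicit.
Unset Printing Implicit Defensive.

Import Order.TTheory GRing.Theory Num.Theory.
Local Open Scope ring_scope.

(* A finite abstract complex is a set of faces over an ambient finType T.  Not
   every point of T need be a vertex, which is what lets a bistellar move
   create a new vertex without changing the ambient type. *)

Section Complexes.

Variable T : finType.
Implicit Types (X Y : {set {set T}}) (a b : {set T}) (x : T).

Definition simplicial_complex X : Prop :=
  set0 \in X /\ (forall a b, a \in X -> b \subset a -> b \in X).

Definition vertices X : {set T} := [set x | [set x] \in X].

(* Dimensions are integers: the empty face has dimension -1. *)
Definition face_dim a : int := #|a|%:Z - 1.

Definition dim X : int := (\max_(a in X) #|a|)%:Z - 1.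

(* The faces of dimension n - 1. *)
Definition faces X (n : nat) : {set {set T}} := [set a in X | #|a| == n].

Definition simplex a : {set {set T}} := [set b : {set T} | b \subset a].

Definition simplex_bd a : {set {set T}} := [set b : {set T} | b \proper a].

Definition join X Y : {set {set T}} := [set a :|: b | a in X, b in Y].

Definition induced X a : {set {set T}} := [set b in X | b \subset a].

Definition link X x : {set {set T}} :=
  [set a in X | (x \notin a) && (x |: a \in X)].

Definition connected X : Prop :=
  {in vertices X &, forall x y, connect [rel u v | [set u; v] \in X] x y}.

Definition two_neighbourly X : Prop :=
  {in vertices X &, forall x y, [set x; y] \in X}.

(* When b = [set v], simplex_bd b = [set set0], so the last condition says
   that a is a face of X and that v is not a vertex of X. *)
Definition bistellar_admissible (d : int) X a b : Prop :=
  [/\ dim X = d, [/\ a != set0, b != set0 & [disjoint a & b]],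
      face_dim a + face_dim b = d
    & induced X (a :|: b) = join (simplex a) (simplex_bd b)].

Definition bistellar_move X a b : {set {set T}} :=
  (X :\: join (simplex a) (simplex_bd b)) :|: join (simplex_bd a) (simplex b).

(* The sum is over i = m - 1, for -1 <= i <= j - 1. *)
Definition g_vector (d : nat) X (j : nat) : int :=
  \sum_(0 <= m < j.+1)
    (-1) ^+ (j - m) * 'C(d + 2 - m, j - m)%:Z * #|faces X m|%:Z.

Variable F : fieldType.

(* Faces are oriented by the enumeration order of T. *)
Definition incidence a b : F :=
  \sum_(x in a | a :\ x == b)
    (-1) ^+ #|[set y in a | (enum_rank y < enum_rank x)%N]|.

(* i-chains are row vectors indexed by the i-dimensional faces, and the boundary
   map on them is u |-> u *m boundary_mx X i.  Homology is not reduced: the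
   boundary of a 0-chain is 0, although faces X 0 contains the empty face. *)
Definition boundary_mx X (i : nat) : 'M[F]_(#|faces X i.+1|, #|faces X i|) :=
  \matrix_(r, c)
    (if i == 0%N then 0 else incidence (enum_val r) (enum_val c)).

(* The dimension of H_i = ker / im.  The subtraction is not truncated for a
   simplicial complex, since the boundary of a boundary is 0. *)
Definition betti X (i : nat) : nat :=
  \rank (kermx (boundary_mx X i)) - \rank (boundary_mx X i.+1).

End Complexes.

Definition isomorphic (T T' : finType) (X : {set {set T}})
    (X' : {set {set T'}}) : Prop :=
  exists f : T -> T', {in vertices X &, injective f}
    /\ X' = [set f @: (a : {set T}) | a in X].

(* The ambient type is an index of the inductive type: passing to an isomorphic
   complex over a larger type supplies the new vertices that moves need. *)
Inductive stellated (k : nat) (d : int) :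
    forall T : finType, {set {set T}} -> Prop :=
| stellated_sphere (T : finType) (c : {set T}) :
    #|c|%:Z = d + 2 -> stellated k d (simplex_bd c)
| stellated_move (T : finType) (X : {set {set T}}) (a b : {set T}) :
    stellated k d X -> bistellar_admissible d X a b ->
    face_dim b < k%:Z -> stellated k d (bistellar_move X a b)
| stellated_iso (T T' : finType) (X : {set {set T}}) (X' : {set {set T'}}) :
    stellated k d X -> isomorphic X X' -> stellated k d X'.

(* The class W_k(d). *)
Definition locally_stellated (k d : nat) (T : finType) (X : {set {set T}}) :
    Prop :=
  [/\ (k <= d)%N, simplicial_complex X, dim X = d%:Z, connected X
    & forall x, x \in vertices X -> stellated k (d%:Z - 1) (link X x)].

(* Main.v *)
Require Import Defs.
From mathcomp Require Import all_boot all_order all_algebra.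
From mathcomp Require Import zify ring.

Set Implicit Arguments.
Unset Strict Implicit.
Unset Printing Implicit Defensive.

Import Order.TTheory GRing.Theory Num.Theory.
Local Open Scope ring_scope.

(** The argument is Morse theory averaged over all orderings of the vertices.

    Adding the vertices of M one at a time builds M through its induced
    subcomplexes; passing from the set W to x |: W attaches a cone over the
    subcomplex of the link of x induced on W.  Let chi_n be the alternating sum
    of the reduced Betti numbers in the faces of size at most n.  The long exact
    sequence of the pair gives
      chi_(n+1) (M[x |: W]) <= chi_(n+1) (M[W]) + chi_n (lk(x)[W]),
    with equality when the reduced homology of lk(x)[W] vanishes at one size
    (trunc_chi_induced_add, trunc_chi_induced_add_eq).  Averaging over the
    orderings makes the left differences telescope (sum_average_diff), so that
    chi_(l+1) (M) + (-1)^l is bounded by the sum over x of the averages of chi_l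
    over the induced subcomplexes of the link of x.  For a connected M,
    chi_(l+1) (M) is the alternating sum of beta_1, ..., beta_l.

    Those averages can be computed because the links are stellated.  Let e be
    their dimension, and let p |-> q be a bistellar move that takes X to Y in
    the construction of one of them.  The subcomplexes X[W] and Y[W] become equal
    once intervals of faces are added to each, and these intervals are acyclic
    unless W meets p :|: q exactly in p or exactly in q.  If the index of every
    move is less than k and n + k <= e, then p has too many vertices to
    influence chi_n, and the move adds (-1)^(n - #|q|) when W meets p :|: q in
    q and #|q| <= n, and at most 0 otherwise (trunc_chi_flip_le,
    trunc_chi_flip_eq).  The average weight of the sets W of this kind is a
    value of the Beta integral that depends on the sizes of p and q only
    (sum_beta_int), while in the generating polynomial of the g-vector the move
    adds 'X^#|q| - 'X^#|p| (gpoly_flip).  So the average of chi_n is bounded by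
    a fixed alternating combination of g_0, ..., g_n of the link
    (flips_average_le), with equality when k <= n (flips_average_eq).

    Finally the sum over x of g_j (lk x) is
    (j+1) g_(j+1) (M) + (d+2-j) g_j (M), and with the Beta weights the
    combinations telescope to g_(l+1) (M) / 'C(d+2, l+1) + (-1)^l, where the sign
    comes from g_0 = 1 (sum_weighted_g).  The signs cancel, and what is left is the
    inequality of the theorem.  For k < n <= e - k the induced subcomplexes of
    the links have no reduced homology in the faces of size n, which gives the
    vanishing of Betti numbers and, with it, the equality case.

    All homology is expressed by ranks of boundary matrices: chi_n is an
    alternating face count minus one rank, the face counts are additive on
    pairs, and the inequality for a pair says that the rank of a block
    triangular matrix is at least the sum of the ranks of its diagonal blocks
    (rk_superadd, rk_additive).

    One point of the definition of a bistellar move needs an argument: only the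
    subcomplex induced on p :|: q is prescribed, and the result is a complex
    because the link of p is no larger than the boundary of q.  This holds
    since both are closed pseudomanifolds of the same dimension; the property
    minimal_cycles is the form of that statement that moves preserve. *)

(** * Matrices indexed by finite sets *)

Section Matrices.

Variables (T : finType) (F : fieldType).
Implicit Types (f g : {set T} -> {set T} -> F) (a b c p q : {set T})
  (S K L R P X Y Z : {set {set T}}) (x y : T) (n : nat).

(** Rows and columns range over all subsets of T, so that the chain groups of
    all subcomplexes, of all dimensions, share one matrix algebra. *)
Definition set_mx f : 'M[F]_#|{set T}| :=
  \matrix_(i, j) f (enum_val i) (enum_val j).

Lemma eq_set_mx f g : (forall a b, f a b = g a b) -> set_mx f = set_mx g.
Proof. by move=> fg; apply/matrixP=> i j; rewrite !mxE fg. Qed.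

Lemma mul_set_mx f g :
  set_mx f *m set_mx g = set_mx (fun a c => \sum_b f a b * g b c).
Proof.
apply/matrixP=> i j; rewrite !mxE [RHS](reindex (@enum_val _ {set T})) /=.
  by apply: eq_bigr => k _; rewrite !mxE.
exact/onW_bij/enum_val_bij.
Qed.

Lemma set_mx0 f : (forall a b, f a b = 0) -> set_mx f = 0.
Proof. by move=> f0; apply/matrixP=> i j; rewrite !mxE f0. Qed.

(** The projection of the chains onto those supported in P. *)
Definition keep P := set_mx (fun a b => ((a == b) && (a \in P))%:R).

Lemma mul_keep_l P f :
  keep P *m set_mx f = set_mx (fun a b => if a \in P then f a b else 0).
Proof.
rewrite mul_set_mx; apply: eq_set_mx => a c; rewrite (bigD1 a) //= eqxx /=.
rewrite big1 ?addr0 => [|b /negbTE nba]; last by rewrite eq_sym nba mul0r.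
by case: (a \in P); rewrite ?mul1r ?mul0r.
Qed.

Lemma mul_keep_r P f :
  set_mx f *m keep P = set_mx (fun a b => if b \in P then f a b else 0).
Proof.
rewrite mul_set_mx; apply: eq_set_mx => a c; rewrite (bigD1 c) //= eqxx /=.
rewrite big1 ?addr0 => [|b /negbTE nba]; last by rewrite nba mulr0.
by case: (c \in P); rewrite ?mulr1 ?mulr0.
Qed.

Definition select P : 'M[F]_(#|P|, #|{set T}|) :=
  \matrix_(r, c) (enum_val r == enum_val c)%:R.

Lemma select_mul P n (A : 'M[F]_(_, n)) r j :
  (select P *m A) r j = A (enum_rank (enum_val r)) j.
Proof.
rewrite mxE (bigD1 (enum_rank (enum_val r))) //= big1 ?addr0 => [|i ni].
  by rewrite mxE enum_rankK eqxx mul1r.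
rewrite !mxE; case: eqP => [ei|_]; last by rewrite mul0r.
by rewrite ei enum_valK eqxx in ni.
Qed.

Lemma select_tr P : select P *m (select P)^T = 1%:M.
Proof.
apply/matrixP=> r c; rewrite select_mul !mxE enum_rankK eq_sym.
by rewrite (inj_eq enum_val_inj).
Qed.

Lemma tr_select P : (select P)^T *m select P = keep P.
Proof.
apply/matrixP=> i j; rewrite !mxE.
have [iP|niP] := boolP (enum_val i \in P); last first.
  rewrite andbF big1 // => r _; rewrite !mxE; case: eqP => [e|_].
    by rewrite -e enum_valP in niP.
  by rewrite mul0r.
rewrite (bigD1 (enum_rank_in iP (enum_val i))) //= !mxE enum_rankK_in //.
rewrite eqxx mul1r andbT big1 ?addr0 // => r nr.
rewrite !mxE; case: eqP => [er|_]; last by rewrite mul0r.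
by case/eqP: nr; apply: enum_val_inj; rewrite enum_rankK_in.
Qed.

Lemma rank_keep P : \rank (keep P) = #|P|.
Proof.
apply/eqP; rewrite eqn_leq; apply/andP; split.
  by rewrite -tr_select (leq_trans (mxrankM_maxr _ _)) ?rank_leq_row.
rewrite -[X in (X <= _)%N](mxrank1 F) -(select_tr P) -[X in X *m _^T]mul1mx.
rewrite -(select_tr P) -(mulmxA (select P)) tr_select.
exact: leq_trans (mxrankM_maxl _ _) (mxrankM_maxr _ _).
Qed.

End Matrices.

(** * The boundary of a boundary vanishes *)

Section Boundary.

Variables (T : finType) (F : fieldType).
Implicit Types (a b c p q U W : {set T})
  (S K L R P X Y Z : {set {set T}}) (x y : T) (n : nat).

Local Notation inc := (@incidence T F).

(** The sign of the face of a that is opposite to x. *)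
Definition face_sign a x : F := (-1) ^+ #|[set y in a | (enum_rank y < enum_rank x)%N]|.

Lemma inc_neq0 a b : inc a b != 0 -> exists2 x, x \in a & b = a :\ x.
Proof.
rewrite /incidence;
  case: (pickP [pred x in a | a :\ x == b]) => [x /= /andP[xa /eqP <-]|none].
  by exists x.
by rewrite big_pred0 ?eqxx.
Qed.

Lemma inc_face a x : x \in a -> inc a (a :\ x) = face_sign a x.
Proof.
move=> xa; rewrite /incidence (bigD1 x) ?xa ?eqxx //= big1 ?addr0 //.
move=> y /andP[/andP[ya /eqP e] nyx]; have: y \in a :\ x by rewrite !inE nyx.
by rewrite -e setD11.
Qed.

Lemma face_sign_sqr a x : face_sign a x * face_sign a x = 1.
Proof. by rewrite /face_sign -expr2 sqrr_sign. Qed.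

Lemma face_sign_setD1 a x y : x \in a -> y \in a -> x != y ->
  face_sign a x = (if (enum_rank y < enum_rank x)%N then -1 else 1) * face_sign (a :\ y) x.
Proof.
move=> xa ya nxy; rewrite /face_sign.
have -> : [set z in a :\ y | (enum_rank z < enum_rank x)%N]
   = [set z in a | (enum_rank z < enum_rank x)%N] :\ y.
  by apply/setP=> z; rewrite !inE andbA.
rewrite [in LHS](cardsD1 y) !inE ya /=.
by case: ifP => _; rewrite ?add0n ?mul1r ?add1n ?exprS.
Qed.

(** The faces a minus {x, y} are reached in two ways, through a minus x and
    through a minus y, with opposite signs.  The sum is split by the order of
    x and y rather than by a sign change, since F may have characteristic 2. *)
Lemma inc_inc a c : \sum_b inc a b * inc b c = 0.
Proof.
have step b : inc a b * inc b c
    = \sum_(x in a | a :\ x == b) face_sign a x * inc (a :\ x) c.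
  rewrite /incidence big_distrl /=; apply: eq_bigr => x /andP[_ /eqP ->] //.
under eq_bigr do rewrite step.
rewrite (exchange_big_dep (mem a)) /=; last by move=> b x _ /andP[].
pose G x y := face_sign a x * face_sign (a :\ x) y.
transitivity (\sum_(x in a) \sum_(y in a | (y != x) && (a :\ x :\ y == c)) G x y).
  apply: eq_bigr => x xa; rewrite (eq_bigl (pred1 (a :\ x))); last first.
    by move=> b; rewrite xa /= eq_sym.
  rewrite big_pred1_eq {1}/incidence big_distrr /=; apply: eq_bigl => y.
  by rewrite !inE; case: (y \in a); rewrite ?andbF ?andbT.
pose lt x y := (enum_rank x < enum_rank y)%N.
rewrite (eq_bigr (fun x =>
   \sum_(y in a | (lt x y) && (a :\ x :\ y == c)) G x y
 + \sum_(y in a | (lt y x) && (a :\ x :\ y == c)) G x y)); last first.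
  move=> x xa; rewrite (bigID (lt x)) /=; congr (_ + _); apply: eq_bigl => y.
    rewrite /lt; case: (eqVneq y x) => [->|_]; rewrite ?ltnn ?andbF //.
    by rewrite -andbA; congr (_ && _); rewrite andbC.
  rewrite /lt -leqNgt leq_eqVlt (inj_eq val_inj) (inj_eq enum_rank_inj).
  by case: (eqVneq y x) => [->|_] /=; rewrite ?ltnn ?andbF // -andbA;
    congr (_ && _); rewrite andbC.
rewrite big_split /= [X in _ + X](exchange_big_dep (mem a)) /=; last first.
  by move=> x y _ /andP[].
rewrite -big_split big1 //= => x xa.
rewrite [X in _ + X](eq_bigl (fun y =>
  (y \in a) && (lt x y && (a :\ x :\ y == c)))); last first.
  by move=> y; rewrite xa /= !setDDl [[set y] :|: _]setUC.
rewrite -big_split big1 //= => y /and3P[ya ltxy _].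
have nxy : x != y by apply: contraTneq ltxy => ->; rewrite /lt ltnn.
rewrite /G (face_sign_setD1 xa ya nxy) (face_sign_setD1 ya xa) 1?eq_sym //.
rewrite -!/(lt _ _) ltxy; move: (ltxy); rewrite /lt => /ltnW; rewrite leqNgt => /negbTE ->.
ring.
Qed.

End Boundary.

(** * Ranks of boundary maps of pairs *)

Definition down_closed (T : finType) (X : {set {set T}}) : Prop :=
  forall a b : {set T}, a \in X -> b \subset a -> b \in X.

Section Ranks.

Variables (T : finType) (F : fieldType).
Implicit Types (a b c p q U W : {set T})
  (S K L R P X Y Z : {set {set T}}) (x y : T) (n : nat).

Local Notation inc := (@incidence T F).
Local Notation keep := (@keep T F).

(** The boundary from faces of size n to faces of size n - 1.  When S = K minus
    L for subcomplexes L of K, it is the boundary of the pair (K, L). *)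
Definition bd S n : 'M[F]_#|{set T}| :=
  set_mx (fun a b => if [&& a \in S, #|a| == n & b \in S] then inc a b else 0).

Definition rk S n := \rank (bd S n).

Lemma in_faces S n a : (a \in faces S n) = (a \in S) && (#|a| == n).
Proof. by rewrite inE. Qed.

Lemma keep_bd P S n (_ : faces S n \subset P) : keep P *m bd S n = bd S n.
Proof.
rewrite mul_keep_l; apply: eq_set_mx => a b; case: ifP => // /negP naP.
case: ifP => // /and3P[aS an _]; case: naP.
by apply: (subsetP (_ : faces S n \subset P)) => //; rewrite in_faces aS.
Qed.

Lemma rk_le S n : (rk S n <= #|faces S n|)%N.
Proof. by rewrite -(rank_keep F) /rk -(keep_bd (subxx _)) mxrankM_maxl. Qed.

Lemma inc_size a b n : inc a b != 0 -> #|a| == n.+1 -> #|b| == n.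
Proof. by case/inc_neq0=> x xa ->; rewrite (cardsD1 x) xa. Qed.

Lemma inc_sub a b : inc a b != 0 -> b \subset a.
Proof. by case/inc_neq0=> x _ ->; apply: subsetDl. Qed.

Lemma bd_bd K n : down_closed K -> bd K n.+1 *m bd K n = 0.
Proof.
move=> clK; rewrite mul_set_mx; apply: set_mx0 => a c.
have [aK|naK] := boolP ((a \in K) && (#|a| == n.+1)); last first.
  by rewrite big1 // => b _; rewrite andbA (negbTE naK) mul0r.
case/andP: aK => aK an; have [cK|ncK] := boolP (c \in K); last first.
  by rewrite big1 // => b _; rewrite !andbF mulr0.
rewrite -[RHS](inc_inc F a c); apply: eq_bigr => b _.
rewrite aK an /= andbT; have [->|nz] := eqVneq (inc a b) 0.
  by rewrite !if_same !mul0r.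
by rewrite (clK _ _ aK (inc_sub nz)) (inc_size nz an).
Qed.

Section Pair.

Variables K L R : {set {set T}}.
Hypotheses (clK : down_closed K) (clL : down_closed L).
Hypotheses (KLR : K = L :|: R) (LR : [disjoint L & R]).

Let inK a : (a \in K) = (a \in L) || (a \in R).
Proof. by rewrite KLR inE. Qed.

Let notLR a : a \in L -> a \in R -> False.
Proof. by move=> aL aR; move/pred0P/(_ a): LR; rewrite /= aL aR. Qed.

Lemma card_faces_pair n : #|faces K n| = (#|faces L n| + #|faces R n|)%N.
Proof.
have -> : faces K n = faces L n :|: faces R n.
  by apply/setP=> a; rewrite !inE inK andb_orl.
rewrite cardsU; have -> : faces L n :&: faces R n = set0; last by rewrite cards0 subn0.
apply/setP=> a; rewrite !inE; apply/negP => /andP[/andP[aL _] /andP[aR _]].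
exact: notLR aL aR.
Qed.

Let bd_keepR n : bd K n *m keep R = bd R n.
Proof.
rewrite mul_keep_r; apply: eq_set_mx => a b.
case: ifP => [bR|nbR]; last by rewrite !andbF.
rewrite !inK bR orbT !andbT; case: (boolP (a \in R)) => [_|naR]; first by rewrite orbT.
rewrite orbF; case: ifP => //= /andP[aL _]; apply: contraTeq bR => nz.
by apply/negP=> /notLR; apply; apply: clL aL (inc_sub nz).
Qed.

Let keepL_bd n : keep (faces L n) *m bd K n = bd L n.
Proof.
rewrite mul_keep_l; apply: eq_set_mx => a b; rewrite in_faces.
rewrite [RHS](_ : _ = if (a \in L) && (#|a| == n) then
                        if (b \in L) then inc a b else 0 else 0); last first.
  by case: (a \in L); case: (_ == _); case: (b \in L).
case: ifP => // /andP[aL an]; rewrite !inK aL an /=.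
have [->|nz] := eqVneq (inc a b) 0; first by rewrite !if_same.
by rewrite (clL aL (inc_sub nz)).
Qed.

Let bdL_keepR n : bd L n *m keep R = 0.
Proof.
rewrite mul_keep_r; apply: set_mx0 => a b; case: ifP => // bR.
by case: ifP => // /and3P[_ _ /notLR]; case/(_ bR).
Qed.

Let bdL_sub n : (bd L n <= bd K n)%MS.
Proof. by rewrite -keepL_bd submxMl. Qed.

(** The boundary of K is block triangular, with diagonal blocks the boundaries
    of L and of the pair (K, L). *)
Lemma rk_superadd n : (rk L n + rk R n <= rk K n)%N.
Proof.
rewrite /rk -(mxrank_mul_ker (bd K n) (keep R)) bd_keepR addnC leq_add2l.
apply: mxrankS; rewrite sub_capmx bdL_sub /=.
by apply/sub_kermxP; rewrite bdL_keepR.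
Qed.

Let bd_bdR n : bd R n.+1 *m bd R n = 0.
Proof.
rewrite -[bd R n.+1]bd_keepR -mulmxA keep_bd ?subsetIl; last first.
  by apply/subsetP => a; rewrite inE => /andP[].
by rewrite -bd_keepR mulmxA bd_bd // mul0mx.
Qed.

Let bdR_sub n : (bd R n.+1 <= keep (faces R n) :&: kermx (bd R n))%MS.
Proof.
rewrite sub_capmx; apply/andP; split; last by apply/sub_kermxP/bd_bdR.
rewrite (_ : bd R n.+1 = bd R n.+1 *m keep (faces R n)) ?submxMl //.
rewrite mul_keep_r; apply: eq_set_mx => a b; rewrite in_faces.
have [->|nz] := eqVneq (inc a b) 0; first by rewrite !if_same.
case: and3P => [[aR an bR]|]; last by rewrite if_same.
by rewrite bR (inc_size nz an).
Qed.

Lemma rk_pair_le n : (rk R n + rk R n.+1 <= #|faces R n|)%N.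
Proof.
have := mxrank_mul_ker (keep (faces R n)) (bd R n).
by rewrite keep_bd // rank_keep => <-; rewrite leq_add2l; apply: mxrankS.
Qed.

(** Equality holds when the relative homology vanishes at size n: every chain
    of K whose boundary lies in L is then a chain of L up to a boundary, so
    the boundaries of K that lie in L are boundaries of L. *)
Lemma rk_additive n : (#|faces R n| <= rk R n + rk R n.+1)%N ->
  rk K n = (rk L n + rk R n)%N.
Proof.
move=> acyclic; apply/eqP; rewrite eqn_leq rk_superadd andbT.
rewrite /rk -(mxrank_mul_ker (bd K n) (keep R)) bd_keepR addnC leq_add2r.
(* No relative homology at size n: the relative cycles are boundaries. *)
have exact_R : (keep (faces R n) :&: kermx (bd R n) <= bd R n.+1)%MS.
  rewrite -(geq_leqif (mxrank_leqif_sup (bdR_sub n))).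
  have := mxrank_mul_ker (keep (faces R n)) (bd R n).
  rewrite keep_bd // rank_keep; move: acyclic; rewrite /rk.
  by move: (\rank (_ :&: _)%MS) => u; lia.
apply/mxrankS/rV_subP => v; rewrite sub_capmx => /andP[/submxP[u ->]].
move/sub_kermxP; rewrite -mulmxA bd_keepR => uR0.
pose u1 := u *m keep (faces R n).
have /submxP[w u1w] : (u1 <= bd R n.+1)%MS.
  apply: submx_trans exact_R; rewrite sub_capmx submxMl /=.
  by apply/sub_kermxP; rewrite -mulmxA keep_bd.
have -> : u *m bd K n = (u - w *m bd K n.+1) *m bd K n.
  by rewrite mulmxBl -mulmxA bd_bd // mulmx0 subr0.
(* Subtracting a boundary moves u into L without changing its boundary. *)
set u' := u - _.
have u'R : u' *m keep (faces R n) = 0.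
  rewrite mulmxBl -/u1 u1w -mulmxA -mulmxBr (_ : _ - _ = 0) ?mulmx0 //.
  apply/eqP; rewrite subr_eq0; apply/eqP; rewrite -bd_keepR !mul_keep_r.
  apply: eq_set_mx => a b; rewrite in_faces.
  case: and3P => [[aK an bK]|]; last by rewrite !if_same.
  have [->|nz] := eqVneq (inc a b) 0; first by rewrite !if_same.
  by rewrite (inc_size nz an) andbT.
rewrite -(keep_bd (subxx (faces K n))) mulmxA.
have -> : keep (faces K n) = keep (faces L n) + keep (faces R n).
  apply/matrixP=> i j; rewrite !mxE -natrD !in_faces inK.
  case: eqP => //= _.
  case: (boolP (_ \in L)) => [aL|_]; case: (boolP (_ \in R)) => [aR|_] //=.
  - by case: (notLR aL aR).
  - by rewrite addn0.
by rewrite mulmxDr u'R addr0 -mulmxA keepL_bd submxMl.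
Qed.

End Pair.

(** On the rows a and the columns a minus v the boundary matrix is diagonal with
    entries 1 or -1, since deleting any point but v leaves v in the face. *)
Lemma rk_matching S v n :
  (#|[set a in faces S n | (v \in a) && (a :\ v \in S)]| <= rk S n)%N.
Proof.
set P := finset _; rewrite -(rank_keep F P).
pose J := set_mx (fun b a => if (v \in a) && (b == a :\ v) then inc a b else 0).
suff <- : keep P *m bd S n *m J = keep P.
  by rewrite (leq_trans (mxrankM_maxl _ _)) ?mxrankM_maxr.
rewrite mul_keep_l mul_set_mx; apply: eq_set_mx => a a'.
have [aP|naP] := boolP (a \in P); last first.
  by rewrite andbF big1 // => b _; rewrite mul0r.
rewrite (bigD1 (a' :\ v)) //= eqxx andbT big1 ?addr0; last first.
  by move=> b /negbTE ->; rewrite andbF mulr0.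
rewrite andbT; move: aP; rewrite !inE => /and3P[/andP[aS an] va avS].
rewrite aS an /=; case: (eqVneq a a') => [<-|naa'].
  by rewrite va avS inc_face // face_sign_sqr.
case: (boolP (v \in a')) => [va'|_]; last by rewrite mulr0.
case: ifP => _; last by rewrite mul0r.
have [->|nz] := eqVneq (inc a (a' :\ v)) 0; first by rewrite mul0r.
case/inc_neq0: nz => y ya e.
have yv : y = v.
  apply/eqP; rewrite eq_sym; apply: contraFT (setD11 v a') => nvy.
  by rewrite e !inE nvy.
by case/eqP: naa'; rewrite -(setD1K va) -(setD1K va') e yv.
Qed.

End Ranks.

(** * Truncated Euler characteristics *)

Section Truncated.

Variables (T : finType) (F : fieldType).
Implicit Types (a b c p q U W : {set T})
  (S K L R P X Y Z : {set {set T}}) (x y : T) (n : nat).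

Local Notation inc := (@incidence T F).

(** The alternating sum of the reduced Betti numbers at the sizes 0, ..., n.
    The ranks cancel in consecutive terms, and only the last one is left. *)
Definition trunc_chi S n : int :=
  \sum_(0 <= m < n.+1) (-1) ^+ (n - m) * #|faces S m|%:Z - (rk F S n.+1)%:Z.

Lemma rk0 S : rk F S 0 = 0%N.
Proof.
rewrite /rk /bd set_mx0 ?mxrank0 // => a b; case: ifP => // /and3P[_ a0 _].
by apply: contraTeq a0 => /inc_neq0[x xa _]; rewrite cards_eq0; apply/set0Pn; exists x.
Qed.

Lemma trunc_chi0 S : trunc_chi S 0 = #|faces S 0|%:Z - (rk F S 0)%:Z - (rk F S 1)%:Z.
Proof. by rewrite /trunc_chi big_nat1 rk0 mul1r subr0. Qed.

(** The right side is the reduced Betti number at size n + 1. *)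
Lemma trunc_chiS S n :
  trunc_chi S n.+1 + trunc_chi S n
    = #|faces S n.+1|%:Z - (rk F S n.+1)%:Z - (rk F S n.+2)%:Z.
Proof.
rewrite /trunc_chi [X in X - _ + _]big_nat_recr //= subnn expr0 mul1r.
rewrite [X in X + _ - _](_ : _ = - \sum_(0 <= m < n.+1) (-1) ^+ (n - m) * #|faces S m|%:Z).
  ring.
rewrite -sumrN; apply: eq_big_nat => m /andP[_ mn].
by rewrite subSn // exprS mulN1r mulNr.
Qed.

Lemma trunc_chi_set0 n : trunc_chi set0 n = 0.
Proof.
have f0 m : faces (set0 : {set {set T}}) m = set0 by apply/setP=> a; rewrite !inE.
rewrite /trunc_chi big1_seq => [|m _]; last by rewrite f0 cards0 mulr0.
have := rk_le F (set0 : {set {set T}}) n.+1; rewrite f0 cards0 leqn0 => /eqP ->.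
by rewrite subr0.
Qed.

Lemma trunc_chi_subadd K L R n : down_closed K -> down_closed L ->
  K = L :|: R -> [disjoint L & R] ->
  trunc_chi K n <= trunc_chi L n + trunc_chi R n.
Proof.
move=> clK clL KLR LR; have := rk_superadd F clL KLR LR n.+1.
rewrite /trunc_chi (eq_bigr _ (fun m _ =>
  congr1 (fun u => _ * Posz u) (card_faces_pair KLR LR m))).
under eq_bigr do rewrite PoszD mulrDr; rewrite big_split /=.
move: (\sum_(_ <= _ < _) _ * Posz #|faces L _|) => u.
by move: (\sum_(_ <= _ < _) _ * Posz #|faces R _|) => v; lia.
Qed.

Lemma trunc_chi_additive K L R n : down_closed K -> down_closed L ->
  K = L :|: R -> [disjoint L & R] ->
  (#|faces R n.+1| <= rk F R n.+1 + rk F R n.+2)%N ->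
  trunc_chi K n = trunc_chi L n + trunc_chi R n.
Proof.
move=> clK clL KLR LR acyclic; have := rk_additive clK clL KLR LR acyclic.
rewrite /trunc_chi (eq_bigr _ (fun m _ =>
  congr1 (fun u => _ * Posz u) (card_faces_pair KLR LR m))).
under eq_bigr do rewrite PoszD mulrDr; rewrite big_split /=.
move: (\sum_(_ <= _ < _) _ * Posz #|faces L _|) => u.
by move: (\sum_(_ <= _ < _) _ * Posz #|faces R _|) => v; lia.
Qed.

Definition interval p q : {set {set T}} :=
  [set a : {set T} | (p \subset a) && (a \subset q)].

Lemma in_interval p q a : (a \in interval p q) = (p \subset a) && (a \subset q).
Proof. by rewrite inE. Qed.

(** A point v of q outside p matches the faces of the interval that avoid v
    with those that contain it, and the matching bounds two consecutive
    ranks from below. *)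
Lemma interval_acyclic p q n : p != q \/ #|p| != n ->
  (#|faces (interval p q) n| <= rk F (interval p q) n + rk F (interval p q) n.+1)%N.
Proof.
move=> pqn; case: (boolP (p \subset q)) => [pq|npq]; last first.
  rewrite (_ : faces _ _ = set0) ?cards0 //; apply/setP=> a; rewrite !inE.
  by apply: contraNF npq => /andP[/andP[pa aq] _]; apply: subset_trans aq.
case: (eqVneq p q) pqn => [<-|npq _].
  case=> // np; rewrite (_ : faces _ _ = set0) ?cards0 //; apply/setP=> a; rewrite !inE.
  by apply: contraNF np => /andP[/andP[pa ap] /eqP <-]; rewrite eqn_leq !subset_leq_card.
have [v vq vp] : exists2 v, v \in q & v \notin p.
  by apply/subsetPn; apply: contra npq => qp; rewrite eqEsubset pq.
have inv a : a :\ v \in interval p q = (a :\ v \subset q) && (p \subset a).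
  by rewrite in_interval subsetD1 vp andbT andbC.
apply: leq_trans (leq_add (rk_matching F _ v n) (rk_matching F _ v n.+1)).
rewrite -(cardsID [set a : {set T} | v \in a] (faces (interval p q) n)) leq_add //.
  apply: subset_leq_card; apply/subsetP=> a; rewrite !inE.
  case/andP=> /andP[/andP[pa aq] an] va; rewrite pa aq an va /= subsetD1 vp andbT pa.
  exact: subset_trans (subsetDl _ _) aq.
rewrite -(card_in_imset (f := setU [set v])).
  apply: subset_leq_card; apply/subsetP=> _ /imsetP[a + ->]; rewrite !inE eqxx /=.
  case/andP=> nva /andP[/andP[pa aq] /eqP an].
  rewrite setU1K // pa aq cardsU1 nva an add1n eqxx subUset sub1set vq aq !andbT.
  by apply: subset_trans pa (subsetUr _ _).
move=> a b; rewrite !inE => /andP[nva _] /andP[nvb _] e.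
by rewrite -(setU1K nva) -(setU1K nvb) e.
Qed.

Lemma powerset_interval p q :
  powerset q = [set a in powerset q | ~~ (p \subset a)] :|: interval p q.
Proof.
by apply/setP=> a; rewrite !inE; case: (p \subset a); rewrite ?andbF ?andbT ?orbF.
Qed.

Lemma rk_interval_le p q n :
  (rk F (interval p q) n + rk F (interval p q) n.+1 <= #|faces (interval p q) n|)%N.
Proof.
apply: (@rk_pair_le T F (powerset q) [set a in powerset q | ~~ (p \subset a)]).
- by move=> a b; rewrite !inE => aq ba; apply: subset_trans aq.
- move=> a b; rewrite !inE => /andP[aq pa] ba; rewrite (subset_trans ba aq) /=.
  by apply: contra pa => pb; apply: subset_trans ba.
- exact: powerset_interval.
- rewrite -setI_eq0; apply/eqP/setP=> a; rewrite !inE.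
  by case: (p \subset a); rewrite ?andbF.
Qed.

Lemma trunc_chi_interval_neq p q n : p != q -> trunc_chi (interval p q) n = 0.
Proof.
move=> npq; have b m : #|faces (interval p q) m|%:Z
    - (rk F (interval p q) m)%:Z - (rk F (interval p q) m.+1)%:Z = 0.
  have := rk_interval_le p q m.
  have := @interval_acyclic p q m (or_introl npq); lia.
elim: n => [|n IH]; first by rewrite trunc_chi0 b.
by have := trunc_chiS (interval p q) n; rewrite b IH addr0.
Qed.

Lemma trunc_chi_interval_eq p n :
  trunc_chi (interval p p) n = if (#|p| <= n)%N then (-1) ^+ (n - #|p|) else 0.
Proof.
have fp m : #|faces (interval p p) m| = (m == #|p|).
  case: eqP => [->|nm].
    rewrite (_ : faces _ _ = [set p]) ?cards1 //; apply/setP=> a; rewrite !inE.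
    by rewrite -eqEsubset eq_sym; case: eqP => // ->; rewrite eqxx.
  apply/eqP; rewrite cards_eq0; apply/eqP/setP=> a; rewrite !inE -eqEsubset.
  by apply/negP => /andP[/eqP <- /eqP pm]; rewrite pm in nm.
have -> : trunc_chi (interval p p) n
    = \sum_(0 <= m < n.+1) (-1) ^+ (n - m) * #|faces (interval p p) m|%:Z.
  rewrite /trunc_chi (_ : rk _ _ _ = 0%N) ?subr0 //; apply/eqP.
  rewrite mxrank_eq0; apply/eqP/set_mx0 => a b; case: ifP => //.
  rewrite !in_interval -!eqEsubset => /and3P[/eqP <- _ /eqP <-].
  by apply/eqP; apply: contraTT isT => /inc_neq0[x xp e]; rewrite e setD11 in xp.
case: ifP => pn.
  rewrite (bigD1_seq #|p|) ?mem_index_iota ?iota_uniq //= fp eqxx mulr1.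
  by rewrite big1 ?addr0 // => m /negbTE nm; rewrite fp nm mulr0.
rewrite big_nat_cond big1 // => m; rewrite andbT ltnS => /andP[_ mn].
by rewrite fp; case: eqP => [mp|]; rewrite ?mulr0 // -mp mn in pn *.
Qed.

(** * Flips *)

(** The bistellar move from p to q seen through membership: inside p :|: q, X
    consists of the faces not containing q and Y of those not containing p.
    This form is symmetric, makes sense for empty q, and treats a new vertex
    like any other. *)
Definition flip (X Y : {set {set T}}) p q : Prop :=
  (forall a, a \subset p :|: q ->
     ((a \in X) = ~~ (q \subset a)) * ((a \in Y) = ~~ (p \subset a)))
  /\ (forall a, ~~ (a \subset p :|: q) -> (a \in X) = (a \in Y)).

Lemma flip_sym X Y p q : flip X Y p q -> flip Y X q p.
Proof.
case=> h1 h2; split=> a; rewrite setUC => ha; last by rewrite h2.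
by split; rewrite (h1 _ ha).
Qed.

Lemma down_closed_induced X a : down_closed X -> down_closed (induced X a).
Proof.
move=> clX b c; rewrite !inE => /andP[bX ba] cb.
by rewrite (clX _ _ bX cb) (subset_trans cb ba).
Qed.

(** Both sides of a flip have the same union with the full simplex on p :|: q,
    and what that union adds to either of them is an interval. *)
Lemma flip_pair X Y p q W (Z := X :|: powerset (p :|: q)) : down_closed X -> flip X Y p q ->
  [/\ down_closed (induced Z W), 
      induced Z W = induced X W :|: interval q (W :&: (p :|: q))
    & [disjoint induced X W & interval q (W :&: (p :|: q))] ].
Proof.
move=> clX [h1 h2]; split.
- apply: down_closed_induced => a b; rewrite !inE => /orP[aX|apq] ba.
    by rewrite (clX _ _ aX ba).
  by rewrite (subset_trans ba apq) orbT.
- apply/setP=> a; rewrite !inE subsetI.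
  case: (boolP (a \subset W)); rewrite ?andbF ?andbT //= => _.
  case: (boolP (a \subset p :|: q)) => apq; rewrite ?orbT ?orbF ?andbF ?orbF //.
  by rewrite (h1 _ apq) andbT orNb.
- rewrite -setI_eq0; apply/eqP/setP=> a; rewrite !inE subsetI.
  apply/negP=> /andP[/andP[aX _] /and3P[qa _ apq]].
  by rewrite (h1 _ apq) qa in aX.
Qed.

Lemma flip_union X Y p q : flip X Y p q ->
  X :|: powerset (p :|: q) = Y :|: powerset (q :|: p).
Proof.
case=> _ h2; apply/setP=> a; rewrite !inE [q :|: p]setUC.
by case: (boolP (a \subset p :|: q)) => ha; rewrite ?orbT // !orbF h2.
Qed.

(** What a flip adds to the truncated Euler characteristic of the subcomplex
    induced on W: the face q appears alone when p :|: q meets W in q. *)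
Definition flip_jump p q n W : int :=
  if (W :&: (p :|: q) == q) && (#|q| <= n)%N then (-1) ^+ (n - #|q|) else 0.

Section Flip.

Variables (X Y : {set {set T}}) (p q W : {set T}) (n : nat).
Hypotheses (clX : down_closed X) (clY : down_closed Y) (flXY : flip X Y p q).
Hypothesis (np : (n.+1 < #|p|)%N).

Let trunc_chi_union :
  trunc_chi (induced (X :|: powerset (p :|: q)) W) n = trunc_chi (induced Y W) n.
Proof.
rewrite (flip_union flXY).
have [clZ ZY dis] := flip_pair W clY (flip_sym flXY).
rewrite (trunc_chi_additive clZ _ ZY dis); first last.
- by apply: interval_acyclic; right; rewrite gtn_eqF.
- exact: down_closed_induced.
case: (eqVneq p (W :&: (q :|: p))) => [<-|npq]; last first.
  by rewrite trunc_chi_interval_neq ?addr0.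
by rewrite trunc_chi_interval_eq leqNgt (ltn_trans _ np) ?addr0.
Qed.

Let trunc_chi_jump : trunc_chi (interval q (W :&: (p :|: q))) n = flip_jump p q n W.
Proof.
rewrite /flip_jump eq_sym; case: eqP => [<-|/eqP npq].
  by rewrite trunc_chi_interval_eq.
by rewrite trunc_chi_interval_neq.
Qed.

(** The interval removed with p is either acyclic or a single face of size
    larger than n + 1, which affects no rank that counts. *)
Lemma trunc_chi_flip_le :
  trunc_chi (induced Y W) n <= trunc_chi (induced X W) n + flip_jump p q n W.
Proof.
have [clZ ZX dis] := flip_pair W clX flXY.
rewrite -trunc_chi_union -trunc_chi_jump; apply: trunc_chi_subadd clZ _ ZX dis.
exact: down_closed_induced.
Qed.

(** A new face of size n + 1 could kill a cycle of size n instead of creating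
    one, and this is the only case in which the inequality can be strict. *)
Lemma trunc_chi_flip_eq : #|q| != n.+1 ->
  trunc_chi (induced Y W) n = trunc_chi (induced X W) n + flip_jump p q n W.
Proof.
move=> qn; have [clZ ZX dis] := flip_pair W clX flXY.
rewrite -trunc_chi_union -trunc_chi_jump; apply: trunc_chi_additive clZ _ ZX dis _.
  exact: down_closed_induced.
by apply: interval_acyclic; right.
Qed.

End Flip.

(** * Cones and vertex links *)

Lemma rank_reindex (f g : {set T} -> {set T} -> F) (u v : {set T} -> F)
    (h : {set T} -> {set T}) :
  (forall a c, f a c = u a * v c * g (h a) (h c)) ->
  (\rank (set_mx f) <= \rank (set_mx g))%N.
Proof.
move=> fE; pose A := set_mx (fun a b => u a * (b == h a)%:R).
pose B := set_mx (fun b c => v c * (b == h c)%:R).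
suff -> : set_mx f = A *m set_mx g *m B.
  exact: leq_trans (mxrankM_maxl _ _) (mxrankM_maxr _ _).
rewrite !mul_set_mx; apply: eq_set_mx => a c; rewrite fE.
rewrite (bigD1 (h c)) //= [X in _ = _ + X]big1 => [|b /negbTE ->]; last by rewrite !mulr0.
rewrite (bigD1 (h a)) //= [X in _ = (_ + X) * _ + _]big1 => [|b /negbTE ->].
  by rewrite !eqxx !mulr1 !addr0 mulrAC.
by rewrite mulr0 mul0r.
Qed.

(** The cone without its base, so the relative chains of the cone over S. *)
Definition cone x S : {set {set T}} := [set x |: a | a in S].

(** Joining x to a changes the orientation by this sign. *)
Definition cone_sign x a : F := (-1) ^+ #|[set y in a | (enum_rank x < enum_rank y)%N]|.

Lemma cone_sign_sqr x a : cone_sign x a * cone_sign x a = 1.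
Proof. by rewrite /cone_sign -expr2 sqrr_sign. Qed.

Lemma inc_cone x a b : x \notin a -> x \notin b ->
  inc (x |: a) (x |: b) = cone_sign x a * cone_sign x b * inc a b.
Proof.
move=> xa xb; case: (pickP [pred y in a | b == a :\ y]) => [y /= /andP[ya /eqP bE]|none].
  have nxy : x != y by apply: contraNneq xa => ->.
  have cE : x |: b = (x |: a) :\ y.
    by rewrite bE setDUl; congr (_ :|: _); apply/esym/setDidPl; rewrite disjoints1 inE.
  have := @face_sign_setD1 T F (x |: a) y x.
  rewrite !inE eqxx ya orbT eq_sym => /(_ isT isT nxy) sE.
  rewrite cE bE !inc_face ?inE ?ya ?orbT // sE.
  rewrite setU1K //; congr (_ * _); rewrite /cone_sign.
  rewrite [in X in _ = X * _](cardsD1 y) !inE ya /=.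
  have -> : [set z in a :\ y | (enum_rank x < enum_rank z)%N]
    = [set z in a | (enum_rank x < enum_rank z)%N] :\ y.
    by apply/setP=> z; rewrite !inE andbA.
  rewrite exprD -mulrA -expr2 sqrr_sign mulr1.
  by case: ifP.
have -> : inc a b = 0.
  apply/eqP; apply: contraT => /inc_neq0[y ya bE].
  by have := none y; rewrite /= ya bE eqxx.
rewrite mulr0; apply/eqP; apply: contraT => /inc_neq0[y yxa e].
have nyx : y != x.
  apply/negP=> /eqP yx; have : x \in x |: b by rewrite setU11.
  by rewrite e yx setD11.
have ya : y \in a by move: yxa; rewrite !inE (negbTE nyx).
have := none y; rewrite /= ya /=; case: eqP => // nb _; case: nb.
apply/setP=> z; rewrite !inE; have /setP/(_ z) := e; rewrite !inE.
case: (eqVneq z x) => [->|_] //=.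
by rewrite (negbTE xa) (negbTE xb) !andbF.
Qed.

Lemma cone_inj x S : {in S, forall a, x \notin a} -> {in S &, injective (setU [set x])}.
Proof.
by move=> nx a b aS bS e; rewrite -(setU1K (nx _ aS)) -(setU1K (nx _ bS)) e.
Qed.

Lemma in_cone x S a : {in S, forall a, x \notin a} ->
  (a \in cone x S) = (x \in a) && (a :\ x \in S).
Proof.
move=> nx; apply/imsetP/andP => [[b bS ->]|[xa aS]]; last first.
  by exists (a :\ x); rewrite ?setD1K.
by rewrite setU11 setU1K ?nx.
Qed.

Lemma card_faces_cone x S n : {in S, forall a, x \notin a} ->
  #|faces (cone x S) n.+1| = #|faces S n|.
Proof.
move=> nx; have -> : faces (cone x S) n.+1 = [set x |: a | a in faces S n].
  apply/setP=> a; rewrite inE; apply/andP/imsetP => [[/imsetP[b bS ->]]|[b]].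
    by rewrite cardsU1 nx // => bn; exists b; rewrite // inE bS.
  rewrite inE => /andP[bS /eqP bn] ->; split; first exact: imset_f.
  by rewrite cardsU1 nx // bn.
rewrite card_in_imset // => a b; rewrite !inE => /andP[aS _] /andP[bS _].
exact: (cone_inj nx).
Qed.

Lemma rk_cone x S n : {in S, forall a, x \notin a} -> rk F (cone x S) n.+1 = rk F S n.
Proof.
move=> nx; apply/eqP; rewrite eqn_leq; apply/andP; split.
  apply: (@rank_reindex _ _ (fun a => (x \in a)%:R * cone_sign x (a :\ x))
    (fun a => (x \in a)%:R * cone_sign x (a :\ x)) (fun a => a :\ x)) => a c.
  rewrite !in_cone //; case: (boolP (x \in a)) => xa; rewrite ?mul0r //=.
  case: (boolP (x \in c)) => xc; rewrite ?mul0r ?mulr0 ?andbF ?mul0r //=.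
  rewrite !mul1r [#|a|](cardsD1 x) xa add1n eqSS.
  case: ifP => _; last by rewrite mulr0.
  by rewrite -{1}(setD1K xa) -{1}(setD1K xc) inc_cone ?setD11.
apply: (@rank_reindex _ _ (fun a => (x \notin a)%:R * cone_sign x a)
    (fun a => (x \notin a)%:R * cone_sign x a) (fun a => x |: a)) => a c.
rewrite !in_cone // !setU11 /=.
have [aS|naS] := boolP (a \in S); last first.
  case: (boolP (x \in a)) => xa; rewrite /= ?mul0r //.
  by rewrite setU1K // (negbTE naS) mulr0.
have [cS|ncS] := boolP (c \in S); last first.
  case: (boolP (x \in c)) => xc; rewrite /= ?mul0r ?mulr0 ?mul0r ?andbF //.
  by rewrite (setU1K xc) (negbTE ncS) !andbF mulr0.
rewrite !setU1K ?nx // aS cS cardsU1 nx // add1n eqSS inc_cone ?nx //= !mul1r.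
case: ifP => _; last by rewrite mulr0.
rewrite mulrA -[X in X * _](_ : 1 = _) ?mul1r //.
by rewrite mulrACA !cone_sign_sqr mulr1.
Qed.

Lemma trunc_chi_cone x S n : {in S, forall a, x \notin a} ->
  trunc_chi (cone x S) n.+1 = trunc_chi S n.
Proof.
move=> nx; rewrite /trunc_chi rk_cone // big_nat_recl //=.
rewrite (_ : faces _ 0 = set0) ?cards0 ?mulr0 ?add0r; last first.
  apply/setP=> a; rewrite !inE in_cone //; apply/negP=> /andP[/andP[xa _]].
  by rewrite cards_eq0 => /eqP a0; rewrite a0 inE in xa.
by congr (_ - _); apply: eq_bigr => m _; rewrite subSS card_faces_cone.
Qed.

Lemma link_notin X x W : {in induced (link X x) W, forall a, x \notin a}.
Proof. by move=> a; rewrite !inE => /andP[/andP[_ /andP[]]]. Qed.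

Lemma induced_add X x W : down_closed X -> x \notin W ->
  induced X (x |: W) = induced X W :|: cone x (induced (link X x) W)
  /\ [disjoint induced X W & cone x (induced (link X x) W)].
Proof.
move=> clX xW; have lknx := @link_notin X x W; split.
  apply/setP=> a; rewrite inE [RHS]inE in_cone // !inE eqxx.
  case: (boolP (x \in a)) => xa /=.
    rewrite setD1K // subDset; case: (boolP (a \in X)) => aX; rewrite ?andbF //=.
    rewrite (clX _ _ aX (subsetDl _ _)) /=.
    case: (boolP (a \subset W)) => //= aW; by rewrite (subsetP aW _ xa) in xW.
  rewrite orbF; congr (_ && _).
  rewrite -[in RHS](setU1K xW) subsetD1 xa andbT //.
rewrite -setI_eq0; apply/eqP/setP=> a; rewrite inE in_cone // !inE.
apply/negP=> /andP[/andP[_ aW] /andP[xa _]].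
by rewrite (subsetP aW _ xa) in xW.
Qed.

End Truncated.

(** * Cycles of facets *)

Section Pseudo.

Variables (T : finType) (e : nat).
Implicit Types (a b c p q r U W : {set T}) (x y z : T) (X Y : {set {set T}})
  (u : {set T} -> bool).

(** A set of facets of the star of a; the sets are Boolean functions because
    cycles modulo 2 are added with addb. *)
Definition star_chain X a u : Prop :=
  forall b, u b -> [/\ b \in X, a \subset b & #|b| = e.+1].

(** Cycle modulo 2, relative to the faces that do not contain a: each ridge of
    the star of a lies in an even number of chosen facets. *)
Definition star_cycle a u : Prop :=
  forall r, a \subset r -> #|r| = e ->
    \big[addb/false]_(b : {set T} | r \subset b) u b = false.

(** X is pure of dimension e, and each star is strongly connected in the sense
    that no nonempty cycle of facets omits a facet.  Spheres have the property,
    and it is what forces the link of p to be the boundary of q when p is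
    flipped to q. *)
Definition minimal_cycles X : Prop :=
  [/\ down_closed X,
      forall a, a \in X -> exists2 b, b \in X & (a \subset b) && (#|b| == e.+1)
    & forall a u, star_chain X a u -> star_cycle a u -> (exists b, u b) ->
        forall b, b \in X -> a \subset b -> #|b| = e.+1 -> u b].

Lemma addb_pair (P : pred {set T}) u b c : b != c -> P b -> P c ->
  (forall d, P d -> u d -> d = b \/ d = c) ->
  \big[addb/false]_(d | P d) u d = u b (+) u c.
Proof.
move=> bc Pb Pc only; rewrite (bigD1 b) //= (bigD1 c) ?Pc 1?eq_sym //=.
rewrite big1 ?addbF // => d /andP[/andP[Pd db] dc].
by apply/negP => /(only _ Pd) [] E; rewrite E eqxx in db dc.
Qed.

Section Flip.

Variables (X Y : {set {set T}}) (p q : {set T}).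
Hypotheses (minX : minimal_cycles X) (flXY : flip X Y p q) (dpq : [disjoint p & q]).
Hypotheses (spq : (#|p| + #|q|)%N = e.+2).

Let clX : down_closed X. Proof. by case: minX. Qed.
Let s := p :|: q.

Let card_s : #|s| = e.+2.
Proof. by rewrite /s cardsU (disjoint_setI0 dpq) cards0 subn0. Qed.

Let inX a : a \subset s -> (a \in X) = ~~ (q \subset a).
Proof. by case: flXY => h _ /h[-> _]. Qed.

Let inY a : a \subset s -> (a \in Y) = ~~ (p \subset a).
Proof. by case: flXY => h _ /h[_ ->]. Qed.

Let inXY a : ~~ (a \subset s) -> (a \in X) = (a \in Y).
Proof. by case: flXY => _ h /h. Qed.

Let card_facet y : y \in s -> #|s :\ y| = e.+1.
Proof. by move=> ys; apply: succn_inj; rewrite -card_s (cardsD1 y s) ys. Qed.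

Let sub_facet a y : a \subset s -> y \notin a -> a \subset s :\ y.
Proof. by move=> als ya; rewrite subsetD1 als. Qed.

Let notsub_facet a y : y \in a -> a \subset s :\ y = false.
Proof. by move=> ya; rewrite subsetD1 ya andbF. Qed.

Let facetP b : b \subset s -> #|b| = e.+1 -> exists2 y, y \in s & b = s :\ y.
Proof.
move=> bs cb; have : (#|s :\: b| == 1)%N.
  by rewrite cardsDS // card_s cb subSnn.
case/cards1P=> y sE; have : y \in s :\: b by rewrite sE inE eqxx.
rewrite inE => /andP[yb ys]; exists y => //; apply/eqP.
by rewrite eqEcard card_facet // cb leqnn andbT sub_facet.
Qed.

Let pq_notin x : x \in p -> x \in q = false.
Proof. by move=> xp; apply: (disjointFr dpq). Qed.

Let qp_notin x : x \in q -> x \in p = false.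
Proof. by move=> xp; apply: (disjointFl dpq). Qed.

Let facetY y : y \in s -> (s :\ y \in Y) = (y \in p).
Proof.
move=> ys; rewrite inY ?subsetDl // subsetD1 subsetUl /=.
by rewrite negbK.
Qed.

Let facetX y : y \in s -> (s :\ y \in X) = (y \in q).
Proof.
by move=> ys; rewrite inX ?subsetDl // subsetD1 subsetUr /= negbK.
Qed.

Let ridge_facet y z : y \in s -> z \in s -> y != z -> #|s :\ y :\ z| = e.
Proof.
move=> ys zs nyz; apply: succn_inj; rewrite -(card_facet ys) (cardsD1 z (s :\ y)).
by rewrite in_setD1 eq_sym nyz zs.
Qed.

Let over_ridge y z b : y \in s -> z \in s -> y != z -> b \subset s -> #|b| = e.+1 ->
  s :\ y :\ z \subset b -> b = s :\ y \/ b = s :\ z.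
Proof.
move=> ys zs nyz bs cb rb; have [w ws E] := facetP bs cb.
rewrite E in rb *; have : w \notin s :\ y :\ z.
  by apply: contraTN rb => wr; rewrite notsub_facet.
by rewrite !in_setD1 ws andbT negb_and !negbK => /orP[] /eqP ->; [right|left].
Qed.

Let facet_neq y z : y \in s -> y != z -> s :\ y != s :\ z.
Proof.
by move=> ys nyz; apply/eqP => /setP/(_ y); rewrite !in_setD1 eqxx ys nyz.
Qed.

Let ridgeP r : r \subset s -> #|r| = e ->
  exists v w, [/\ v \in s, w \in s, v != w & r = s :\ v :\ w].
Proof.
move=> rs cr; have /cards2P[v [w [nvw vw]]] : #|s :\: r| == 2.
  by rewrite cardsDS // card_s cr -addn2 addKn.
have : v \in s :\: r by rewrite vw !inE eqxx.
have : w \in s :\: r by rewrite vw !inE eqxx orbT.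
rewrite !in_setD => /andP[wr ws] /andP[vr vs]; exists v, w; split => //.
apply/eqP; rewrite eqEcard ridge_facet // cr leqnn andbT subsetD1 wr andbT.
by rewrite subsetD1 vr rs.
Qed.

(** The ridge s minus {v, w} lies in exactly two facets of the simplex on s. *)
Let ridge_sum u v w : v \in s -> w \in s -> v != w ->
  (forall d, u d -> s :\ v :\ w \subset d -> d \subset s /\ #|d| = e.+1) ->
  \big[addb/false]_(b : {set T} | s :\ v :\ w \subset b) u b = u (s :\ v) (+) u (s :\ w).
Proof.
move=> vs ws nvw full; apply: addb_pair; rewrite ?facet_neq ?subsetDl //.
  by rewrite setDDl setUC -setDDl subsetDl.
by move=> d rd ud; have [ds cd] := full _ ud rd; apply: over_ridge.
Qed.

(** The facets obtained from p and the proper faces of q by removing one point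
    of q form a nonempty cycle of the star of p, hence the whole star. *)
Lemma flip_star b : b \in X -> p \subset b -> b \subset s.
Proof.
move=> bX pb; have [y yq | q0] := pickP (mem q); last first.
  have := inX (subsetUr p q); rewrite subxx => /negP[]; apply: clX bX _.
  by apply/subsetP=> z; rewrite [z \in q]q0.
have ys : y \in s by rewrite inE (yq : y \in q) orbT.
pose u c := [&& c \subset s, p \subset c & #|c| == e.+1].
have [_ pure min] := minX; have [c cX /andP[bc /eqP cc]] := pure _ bX.
suff /and3P[cs _ _] : u c by apply: subset_trans cs.
apply: (min p) => //.
- move=> d /and3P[ds pd /eqP cd]; split=> //; have [z zs E] := facetP ds cd.
  rewrite E facetX //; move: pd; rewrite E subsetD1 => /andP[_ zp].
  by move: zs; rewrite inE (negbTE zp).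
- move=> r pr cr; have [rs|nrs] := boolP (r \subset s); last first.
    rewrite big1 // => d rd; apply/negP=> /and3P[ds _ _].
    by rewrite (subset_trans rd ds) in nrs.
  have [v [w [vs ws nvw rE]]] := ridgeP rs cr.
  rewrite rE ridge_sum //; last by move=> d /and3P[ds _ /eqP cd].
  move: pr; rewrite rE !subsetD1 => /andP[/andP[_ vp] wp].
  by rewrite /u !subsetDl !card_facet // eqxx !subsetD1 vp wp subsetUl.
- exists (s :\ y); rewrite /u subsetDl card_facet // eqxx andbT /= subsetD1 subsetUl.
  by rewrite qp_notin.
- exact: subset_trans bc.
Qed.

Lemma flip_down_closed : down_closed Y.
Proof.
move=> a b aY ba; have [bs|nbs] := boolP (b \subset s); last first.
  have nas : ~~ (a \subset s) by apply: contra nbs; apply: subset_trans.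
  by rewrite -inXY // (clX _ ba) // inXY.
rewrite inY //; apply/negP=> pb; have pa := subset_trans pb ba.
have [als|nas] := boolP (a \subset s); first by rewrite inY // pa in aY.
have aX : a \in X by rewrite inXY.
by case/negP: nas; apply: flip_star aX pa.
Qed.

(** q is not a face of X, so a face of Y containing q is created by the flip. *)
Let new_facet d : d \in Y -> q \subset d -> d \subset s.
Proof.
move=> dY qd; apply: contraTT (subxx q) => nds; rewrite -inX ?subsetUr //.
by apply: clX qd; rewrite inXY.
Qed.

(** The facets created by the flip are adjacent to each other through ridges
    that contain q, and those lie in no other facet; so a cycle u of Y contains
    all of them or none.  If it contains them, adding the boundary of the whole
    simplex on p :|: q exchanges them for the facets deleted by the flip and
    produces a cycle of X, to which minimality applies. *)
Lemma flip_minimal_cycles : minimal_cycles Y.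
Proof.
have [_ pure min] := minX; have clY := flip_down_closed; split=> //.
  move=> a aY; have [als|nas] := boolP (a \subset s).
    have := aY; rewrite inY // => /subsetPn[z zp za].
    have zs : z \in s by rewrite inE zp.
    by exists (s :\ z); rewrite ?facetY // sub_facet // card_facet /=.
  have [|b bX /andP[ab cb]] := pure a; first by rewrite inXY.
  exists b; rewrite ?ab // -inXY //.
  by apply: contra nas; apply: subset_trans.
move=> a u chain cycle [b0 ub0] b bY ab cb.
have [als|nas] := boolP (a \subset s); last first.
  have notin (d : {set T}) : a \subset d -> ~~ (d \subset s).
    by move=> ad; apply: contra nas; apply: subset_trans ad.
  apply: (min a u) => //; [|by exists b0|by rewrite inXY ?notin].
  by move=> d /chain[dY ad cd]; split=> //; rewrite inXY ?notin.
have aY : a \in Y := clY _ _ bY ab.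
have /subsetPn[z0 z0p z0a] : ~~ (p \subset a) by rewrite -inY.
have ps z : z \in p -> z \in s by move=> zp; rewrite inE zp.
have newE z : z \in p -> z \notin a -> u (s :\ z) = u (s :\ z0).
  move=> zp za; have [->//|nzz] := eqVneq z z0.
  have qr : q \subset s :\ z :\ z0.
    by rewrite !subsetD1 subsetUr !pq_notin.
  have := cycle (s :\ z :\ z0); rewrite ridge_facet ?ps // ridge_sum ?ps //.
    rewrite !subsetD1 als za z0a => /(_ isT erefl).
    by case: (u _); case: (u _).
  move=> d /chain[dY ad cd] rd; split=> //; apply: new_facet => //.
  exact: subset_trans rd.
have facet_Y d : d \in Y -> d \subset s -> a \subset d -> #|d| = e.+1 -> u d = u (s :\ z0).
  move=> dY ds ad cd; have [z zs E] := facetP ds cd.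
  by move: dY ad; rewrite E facetY // subsetD1 => zp /andP[_ za]; apply: newE.
have [qa|/subsetPn[y0 y0q y0a]] := boolP (q \subset a).
  have ins d : d \in Y -> a \subset d -> d \subset s.
    by move=> dY ad; apply: new_facet => //; apply: subset_trans ad.
  have [b0Y ab0 cb0] := chain _ ub0.
  by rewrite facet_Y ?ins // -(facet_Y b0) ?ins.
(* The part in the star of a of the boundary of the simplex on s. *)
pose full (d : {set T}) := [&& a \subset d, d \subset s & #|d| == e.+1].
pose u' (d : {set T}) := u d (+) (u (s :\ z0) && full d).
have chain' : star_chain X a u'.
  move=> d; rewrite /u'; case: (boolP (full d)) => [/and3P[ad ds /eqP cd]|nfull].
    rewrite andbT => ud; split=> //; have [z zs E] := facetP ds cd.
    rewrite E facetX //; move: (zs); rewrite inE => /orP[zp|//].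
    move: ud ad; rewrite E subsetD1 => ud /andP[_ za].
    by rewrite newE // addbb in ud.
  rewrite andbF addbF => /chain[dY ad cd]; split=> //; rewrite inXY //.
  by apply: contra nfull => ds; rewrite /full ad ds cd eqxx.
have cycle' : star_cycle a u'.
  move=> r ar cr; rewrite big_split /= cycle // -big_distrr /=.
  have [rs|nrs] := boolP (r \subset s); last first.
    rewrite big1 ?andbF // => d rd; apply/negP=> /and3P[_ ds _].
    by rewrite (subset_trans rd ds) in nrs.
  have [v [w [vs ws nvw rE]]] := ridgeP rs cr.
  rewrite rE ridge_sum //; last by move=> d /and3P[_ ds /eqP cd].
  move: ar; rewrite rE !subsetD1 => /andP[/andP[_ va] wa].
  by rewrite /full !subsetD1 va wa als !subsetDl !card_facet // eqxx andbF.
have y0s : y0 \in s by rewrite inE y0q orbT.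
have uy0 : u (s :\ y0) = false.
  by apply/negP=> /chain[]; rewrite facetY // qp_notin.
have full_y0 : full (s :\ y0) by rewrite /full subsetD1 als y0a subsetDl card_facet /=.
have all_u' : (exists d, u' d) -> forall d, d \in X -> a \subset d -> #|d| = e.+1 -> u' d.
  exact: min.
have [t|nt] := boolP (u (s :\ z0)); last first.
  have /all_u'/(_ (s :\ y0)) : exists d, u' d by exists b0; rewrite /u' ub0 (negbTE nt).
  rewrite facetX // subsetD1 als y0a card_facet // /u' uy0 (negbTE nt).
  by move=> /(_ y0q isT erefl).
have [bs|nbs] := boolP (b \subset s); first by rewrite facet_Y.
have /all_u'/(_ b) : exists d, u' d by exists (s :\ y0); rewrite /u' uy0 t full_y0.
rewrite inXY // => /(_ bY ab cb); rewrite /u' /full (negbTE nbs) andbF andbF.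
by rewrite addbF.
Qed.

End Flip.
End Pseudo.

(** * The g-vector as a polynomial *)

Section Gpoly.

Variables (T : finType).
Implicit Types (a b c p q r U W : {set T}) (x y z : T) (X Y : {set {set T}}).

(** The recursion for h splits the interval by whether a fixed point of q
    outside p belongs to the set. *)
Lemma sum_interval (V : nmodType) (h : nat -> nat -> V) (D : nat) p q :
  (forall m n, (m <= n < D)%N -> h m n.+1 = h m.+1 n.+1 + h m n) ->
  p \subset q -> (#|q| <= D)%N ->
  \sum_(a in interval p q) h #|a| #|a| = h #|p| #|q|.
Proof.
move=> hS; move: {2}#|q :\: p| (leqnn #|q :\: p|) => n.
elim: n p q => [|n IH] p q.
  rewrite leqn0 cards_eq0 setD_eq0 => qp pq _.
  have -> : q = p by apply/eqP; rewrite eqEsubset qp.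
  rewrite (eq_bigl (pred1 p)) ?big_pred1_eq // => a.
  by rewrite in_interval -eqEsubset eq_sym.
move=> nqp pq qD; have [y yqp | none] := pickP [pred y | y \in q :\: p]; last first.
  apply: IH => //; rewrite (_ : q :\: p = set0) ?cards0 //.
  by apply/setP=> y; rewrite in_set0; apply: none.
move: yqp => /= yqp; have /setDP[yq yp] := yqp.
have qE : #|q| = #|q :\ y|.+1 by rewrite (cardsD1 y) yq.
have pyE : #|y |: p| = #|p|.+1 by rewrite cardsU1 yp.
have sub_q : p \subset q :\ y by rewrite subsetD1 pq.
have sub_p : y |: p \subset q by rewrite subUset sub1set yq.
rewrite (bigID [pred a | y \in (a : {set T})]) /= qE hS; last first.
  by rewrite subset_leq_card //= -qE.
congr (_ + _).
  rewrite -pyE -qE -IH //.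
    by apply: eq_bigl => a; rewrite !in_interval subUset sub1set andbC andbA.
  move: nqp; rewrite (cardsD1 y) yqp add1n ltnS; apply: leq_trans.
  by apply/subset_leq_card/subsetP => z; rewrite !inE negb_or -!andbA.
rewrite -IH //; first by apply: eq_bigl => a; rewrite !in_interval subsetD1 andbA.
  move: nqp; rewrite (cardsD1 y) yqp add1n ltnS; apply: leq_trans.
  by apply/subset_leq_card/subsetP => z; rewrite !inE => /and3P[-> -> ->].
by apply: leq_trans qD; rewrite qE.
Qed.

(** For D = d + 2 the coefficients form the g-vector; a face of size m
    contributes a power of 'X and of 1 - 'X, as in the h-polynomial multiplied
    by 1 - 'X. *)
Definition gpoly (D : nat) X : {poly int} :=
  \sum_(a in X) 'X^#|a| * (1 - 'X) ^+ (D - #|a|).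

Lemma coef_1BXn n i : ((1 - 'X : {poly int}) ^+ n)`_i = (-1) ^+ i * 'C(n, i)%:Z.
Proof.
elim: n i => [|n IH] i.
  by rewrite expr0 coef1 bin0n; case: i => //= i; rewrite mulr0.
rewrite exprS mulrBl mul1r coefB coefXM !IH; case: i => [|i] /=.
  by rewrite !bin0 subr0.
by rewrite binS exprS PoszD; ring.
Qed.

Lemma sum_by_size (V : nmodType) X (f : nat -> V) j :
  (forall m, (j < m)%N -> f m = 0) ->
  \sum_(a in X) f #|a| = \sum_(0 <= m < j.+1) f m *+ #|faces X m|.
Proof.
move=> f0.
transitivity (\sum_(a in X) \sum_(0 <= m < j.+1 | m == #|a|) f m).
  apply: eq_bigr => a _; have [aj|ja] := leqP #|a| j.
    rewrite -big_filter (_ : filter _ _ = [:: #|a|]) ?big_seq1 //.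
    by rewrite filter_pred1_uniq ?iota_uniq // mem_index_iota ltnS.
  rewrite f0 // big1_seq // => m /andP[/eqP -> _]; exact: f0.
rewrite (exchange_big_dep predT) //=; apply: eq_bigr => m _.
rewrite sumr_const; congr (_ *+ _); apply: eq_card => a.
by rewrite !inE eq_sym.
Qed.

Lemma coef_gpoly d X j : (gpoly d.+2 X)`_j = g_vector d X j.
Proof.
pose f m : int := ('X^m * (1 - 'X : {poly int}) ^+ (d.+2 - m))`_j.
rewrite /gpoly coef_sum (@sum_by_size _ X f j); last first.
  by move=> m jm; rewrite /f coefXnM jm.
apply: eq_big_nat => m /andP[_ mj]; rewrite /f coefXnM ltnNge -ltnS mj /=.
by rewrite coef_1BXn addn2 pmulrn -mulrzr intz.
Qed.

Lemma gpoly_set0 D : gpoly D set0 = 0.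
Proof. by rewrite /gpoly big_set0. Qed.

Lemma sum_powerset_flip (V : zmodType) (f : {set T} -> V) X (s q : {set T}) :
  (forall a : {set T}, a \subset s -> (a \in X) = ~~ (q \subset a)) ->
  \sum_(a in X) f a + \sum_(a in interval q s) f a
  = \sum_(a : {set T} | a \subset s) f a + \sum_(a in X | ~~ (a \subset s)) f a.
Proof.
move=> inX; rewrite (bigID (fun a : {set T} => a \subset s) (mem X)) /=.
rewrite addrAC; congr (_ + _).
rewrite [RHS](bigID (fun a : {set T} => q \subset a)) /= addrC; congr (_ + _).
  by apply: eq_bigl => a; rewrite in_interval andbC.
apply: eq_bigl => a; case: (boolP (a \subset s)) => als; rewrite ?andbF //.
by rewrite inX // andbT.
Qed.

(** The terms of the interval from q to p :|: q, like the binomial expansion of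
    ('X + (1 - 'X)) to a power, sum to 'X^#|q|. *)
Lemma gpoly_flip D X Y p q : flip X Y p q -> [disjoint p & q] -> (#|p| + #|q|)%N = D ->
  gpoly D Y = gpoly D X + 'X^#|q| - 'X^#|p|.
Proof.
move=> [h1 h2] dpq pqD.
have cs : #|p :|: q| = D by rewrite cardsU disjoint_setI0 // cards0 subn0.
pose f a : {poly int} := 'X^#|a| * (1 - 'X) ^+ (D - #|a|).
have sumI r : r \subset p :|: q -> \sum_(a in interval r (p :|: q)) f a = 'X^#|r|.
  move=> rs; pose h m n : {poly int} := 'X^m * (1 - 'X) ^+ (D - n).
  rewrite (@sum_interval _ h D) ?cs // /h ?subnn ?mulr1 // => m n /andP[_ nD].
  by rewrite -(subnSK nD) !exprS; ring.
have eX := sum_powerset_flip f (fun a ha => (h1 a ha).1).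
have eY := sum_powerset_flip f (fun a ha => (h1 a ha).2).
rewrite sumI ?subsetUr // in eX; rewrite sumI ?subsetUl // in eY.
have -> : gpoly D X + 'X^#|q| = gpoly D Y + 'X^#|p|; last by rewrite addrK.
rewrite eX eY; congr (_ + _); apply: eq_bigl => a.
by case: (boolP (a \subset _)) => ha; rewrite ?andbF // !andbT h2.
Qed.

Lemma sum_link (V : nmodType) X (f : nat -> V) : down_closed X ->
  \sum_x \sum_(a in link X x) f #|a| = \sum_(b in X) f #|b|.-1 *+ #|b|.
Proof.
move=> clX; transitivity (\sum_x \sum_(b in X | x \in b) f #|b|.-1).
  apply: eq_bigr => x _.
  have nx : {in link X x, forall a, x \notin a} by move=> a; rewrite !inE => /and3P[].
  transitivity (\sum_(b in cone x (link X x)) f #|b|.-1).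
    rewrite big_imset /=; last exact: cone_inj.
    by apply: eq_bigr => a /nx xa; rewrite cardsU1 xa.
  apply: eq_bigl => b; rewrite in_cone // !inE eqxx /=.
  case: (boolP (x \in b)) => xb; rewrite ?andbF //= setD1K // andbT.
  by case: (boolP (b \in X)) => bX; rewrite ?andbF // (clX _ _ bX (subsetDl _ _)).
rewrite (exchange_big_dep (mem X)) /=; last by move=> x b _ /andP[].
apply: eq_bigr => b bX; rewrite -sumr_const; apply: eq_bigl => x.
by rewrite bX.
Qed.

(** A face b of X gives #|b| faces of size #|b| - 1 in the vertex links, and
    differentiation counts them; the right side has no other terms because
    'X + (1 - 'X) = 1. *)
Lemma sum_gpoly_link D X : down_closed X -> (forall a, a \in X -> (#|a| <= D.+1)%N) ->
  \sum_x gpoly D (link X x) = (1 - 'X) * (gpoly D.+1 X)^`() + (gpoly D.+1 X) *+ D.+1.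
Proof.
move=> clX dimX; rewrite (@sum_link _ X (fun n => 'X^n * (1 - 'X) ^+ (D - n))) //.
rewrite /gpoly linear_sum big_distrr /= -sumrMnl -big_split /=; apply: eq_bigr => a aX.
have := dimX _ aX; move: #|a| => n nD.
rewrite derivM derivXn !deriv_exp derivB derivX -(polyC1 int) derivC sub0r mulN1r.
rewrite polyC1; move VE: (1 - 'X : {poly int}) => V; case: n nD => [|n] nD.
  by rewrite !mulr0n mul0r add0r !subn0 expr0 !mul1r /= mulrnAr mulrN -exprS mulNrn addNr.
have [nD'|nD'] := eqVneq n D.
  rewrite nD' !subnn !expr0 !mulr1 mulr0n mulr0 addr0 -VE /= exprS.
  by rewrite mulrBl mul1r mulrnAr subrK.
have -> : (D.+1 - n.+1 = (D - n.+1).+1)%N by lia.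
have -> : (D - n = (D - n.+1).+1)%N by lia.
have -> : D.+1 = (n.+1 + (D - n.+1).+1)%N by lia.
rewrite -VE /= !exprS; ring.
Qed.

Lemma coef_sum_link d X j : down_closed X -> (forall a, a \in X -> (#|a| <= d.+2)%N) ->
  \sum_x (gpoly d.+1 (link X x))`_j
    = j.+1%:Z * (gpoly d.+2 X)`_j.+1 + (d.+2%:Z - j%:Z) * (gpoly d.+2 X)`_j.
Proof.
move=> clX dimX; have := congr1 (fun p : {poly int} => p`_j) (sum_gpoly_link clX dimX).
rewrite coef_sum => ->; rewrite coefD coefMn mulrBl mul1r coefB coefXM !coef_deriv.
have natZ (u : int) n : u *+ n = n%:Z * u by rewrite -mulr_natl natz.
rewrite !natZ; move: (gpoly _ _) => g; case: j => [|j] /=; first by ring.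
move: (g`_j.+2) (g`_j.+1) => u v; lia.
Qed.

End Gpoly.

(** * Averages over subsets *)

(** The integral of t^m (1 - t)^n over the unit interval.  It is the
    probability that, of a random ordering of m + n + 1 points, a given one
    comes after m given points and before the other n. *)
Definition beta_int (m n : nat) : rat := (m`! * n`!)%:R / ((m + n).+1)`!%:R.

Lemma fact_neq0 n : n`!%:R != 0 :> rat.
Proof. by rewrite pnatr_eq0 -lt0n fact_gt0. Qed.

Lemma beta_intS m n : beta_int m n = beta_int m.+1 n + beta_int m n.+1.
Proof.
rewrite /beta_int addSn addnS !factS !natrM; have := fact_neq0 m; have := fact_neq0 n.
have := fact_neq0 (m + n); move: m`! n`! (m + n)`! => a b c.
have h1 : (m + n).+1%:R != 0 :> rat by rewrite pnatr_eq0.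
have h2 : (m + n).+2%:R != 0 :> rat by rewrite pnatr_eq0.
move=> c0 b0 a0; have e2 : (m + n).+2%:R = m.+1%:R + n.+1%:R :> rat.
  by rewrite -natrD addSn addnS.
rewrite e2 in h2 *; move: m.+1%:R n.+1%:R (m + n).+1%:R h1 h2 => u v w w0 uv0.
by field; rewrite c0 w0 uv0.
Qed.

Lemma beta_int_ge0 m n : 0 <= beta_int m n.
Proof. by rewrite divr_ge0 ?ler0n. Qed.

Section Average.

Variables (T : finType).
Implicit Types (a b c p q r U W : {set T}) (x y z : T) (X Y : {set {set T}})
  (phi psi : {set T} -> rat).

(** The expected value of phi at a random subset of U, whose points are chosen
    independently with a probability that is itself uniform in the unit
    interval. *)
Definition average U phi : rat :=
  \sum_(W : {set T} | W \subset U) beta_int #|W| (#|U| - #|W|) * phi W.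

Lemma averageD U phi psi :
  average U (fun W => phi W + psi W) = average U phi + average U psi.
Proof. by rewrite -big_split; apply: eq_bigr => W _; rewrite mulrDr. Qed.

Lemma eq_average U phi psi : (forall W, W \subset U -> phi W = psi W) ->
  average U phi = average U psi.
Proof. by move=> eq_phi; apply: eq_bigr => W WU; rewrite eq_phi. Qed.

Lemma le_average U phi psi : (forall W, W \subset U -> phi W <= psi W) ->
  average U phi <= average U psi.
Proof.
move=> le_phi; apply: ler_sum => W WU.
by rewrite ler_wpM2l ?beta_int_ge0 ?le_phi.
Qed.

Lemma sum_beta_int U p q : p \subset U -> q \subset U -> [disjoint p & q] ->
  \sum_(W in interval q (U :\: p)) beta_int #|W| (#|U| - #|W|) = beta_int #|q| #|p|.
Proof.
move=> pU qU dpq; rewrite (@sum_interval _ _ (fun m n => beta_int m (#|U| - n)) #|U|).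
- by rewrite cardsDS // subKn ?subset_leq_card.
- by move=> m n /andP[_ nU]; rewrite -(subnSK nU) beta_intS.
- by rewrite subsetD qU disjoint_sym.
- exact/subset_leq_card/subsetDl.
Qed.

Lemma average_flip_jump n U p q : p \subset U -> q \subset U -> [disjoint p & q] ->
  average U (fun W => (flip_jump p q n W)%:~R)
    = if (#|q| <= n)%N then (-1) ^+ (n - #|q|) * beta_int #|q| #|p| else 0.
Proof.
move=> pU qU dpq; case: ifP => qn; last first.
  by rewrite /average big1 // => W _; rewrite /flip_jump qn andbF mulr0.
rewrite -(sum_beta_int pU qU dpq) big_distrr /=.
rewrite /average (bigID (fun W => W :&: (p :|: q) == q)) /=.
rewrite [X in _ + X]big1 ?addr0; last first.
  by move=> W /andP[_ /negbTE nW]; rewrite /flip_jump nW mulr0.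
apply: eq_big => [W|W /andP[_ WE]]; last first.
  by rewrite /flip_jump WE qn rmorphXn rmorphN1 mulrC.
rewrite in_interval subsetD -setI_eq0.
apply/andP/and3P => [[WU /eqP E]|[qW WU /eqP Wp]].
  split=> //; first by rewrite -E subsetIl.
  apply/eqP/setP=> z; rewrite !inE; apply/negP=> /andP[zW zp].
  have : z \in q by rewrite -E !inE zW zp.
  by rewrite (disjointFr dpq).
by split=> //; rewrite setIUr Wp set0U; apply/eqP/setIidPr.
Qed.

(** The weight of the pair (x, W) is the probability that a random ordering of
    the points of T lists W first and x next, so that the left side is the
    mean of a telescoping sum. *)
Lemma sum_average_diff phi :
  \sum_x average [set~ x] (fun W => phi (x |: W) - phi W) = phi setT - phi set0.
Proof.
(* w B is the probability that an ordering of T begins with B. *)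
pose N := #|T|; pose w (B : {set T}) : rat := (#|B|`! * (N - #|B|)`!)%:R / N`!%:R.
have cC x : #|[set~ x]| = N.-1 by rewrite cardsC1.
have addE : \sum_x \sum_(W : {set T} | W \subset [set~ x])
      beta_int #|W| (N.-1 - #|W|) * phi (x |: W) = \sum_(B | B != set0) w B * phi B.
  transitivity (\sum_x \sum_(B : {set T} | x \in B) beta_int #|B|.-1 (N - #|B|) * phi B).
    apply: eq_bigr => x _; rewrite [RHS](reindex_onto (setU [set x]) (fun B => B :\ x)) /=.
      apply: eq_big => [W|W].
        rewrite setU11 /=; apply/idP/eqP => [xW|<-].
          by rewrite setU1K //; move: xW; rewrite subsetC sub1set inE.
        by rewrite subsetC sub1set !inE eqxx.
      rewrite subsetC sub1set inE => xW; rewrite cardsU1 xW add1n /=.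
      by rewrite -subn1 -subnDA add1n.
    by move=> B xB; rewrite setD1K.
  rewrite (exchange_big_dep predT) //= [RHS]big_mkcond; apply: eq_bigr => B _.
  have [->|B0] := eqVneq B set0; first by rewrite big_pred0 // => x; rewrite inE.
  rewrite sumr_const -mulr_natl mulrA; congr (_ * _).
  have Bpos : (0 < #|B|)%N by rewrite card_gt0.
  have BN : (#|B| <= N)%N by apply: max_card.
  rewrite /beta_int /w mulrA -natrM mulnA.
  rewrite -[in X in (X * _ * _)%N](prednK Bpos) -factS prednK //.
  by congr (_ / _`!%:R); lia.
have subE : \sum_x \sum_(W : {set T} | W \subset [set~ x])
      beta_int #|W| (N.-1 - #|W|) * phi W = \sum_(B | B != setT) w B * phi B.
  transitivity (\sum_x \sum_(B : {set T} | x \notin B) beta_int #|B| (N.-1 - #|B|) * phi B).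
    by apply: eq_bigr => x _; apply: eq_bigl => W; rewrite subsetC sub1set inE.
  rewrite (exchange_big_dep predT) //= [RHS]big_mkcond; apply: eq_bigr => B _.
  have [->|B0] := eqVneq B setT; first by rewrite big_pred0 // => x; rewrite inE.
  rewrite (eq_bigl [pred x in ~: B]) => [|x]; last by rewrite /= inE.
  rewrite sumr_const -mulr_natl mulrA; congr (_ * _).
  have BN : (#|B| < N)%N.
    by rewrite /N -cardsT proper_card // properT.
  have -> : #|~: B| = (N - #|B|)%N by rewrite cardsCs setCK.
  rewrite /beta_int /w mulrA -natrM mulnCA.
  have -> : (N - #|B| = (N.-1 - #|B|).+1)%N by lia.
  rewrite -factS; congr (_ / _`!%:R); lia.
transitivity (\sum_(B | B != set0) w B * phi B - \sum_(B | B != setT) w B * phi B).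
  rewrite -addE -subE -sumrB; apply: eq_bigr => x _; rewrite -sumrB.
  by apply: eq_bigr => W _; rewrite cC mulrBr.
have wT : w setT = 1 by rewrite /w cardsT subnn fact0 muln1 divff ?fact_neq0.
have w0 : w set0 = 1 by rewrite /w cards0 subn0 fact0 mul1n divff ?fact_neq0.
have h0 : \sum_B w B * phi B = phi set0 + \sum_(B | B != set0) w B * phi B.
  by rewrite (bigD1 set0) //= w0 mul1r.
have hT : \sum_B w B * phi B = phi setT + \sum_(B | B != setT) w B * phi B.
  by rewrite (bigD1 setT) //= wT mul1r.
by apply/eqP; rewrite subr_eq addrAC -hT h0 addrC addKr.
Qed.

End Average.

(** * Averages over the induced subcomplexes of a stellated sphere *)

(** Complexes obtained by flips with at most k points in q, all inside U.  The
    start is the void complex: the boundary of a simplex on c arises from it by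
    the flip with p = c and q empty, so that spheres need no separate treatment
    in the inductions. *)
Inductive flips (e k : nat) (T : finType) (U : {set T}) : {set {set T}} -> Prop :=
| flips_void : flips e k U set0
| flips_step (X Y : {set {set T}}) (p q : {set T}) :
    flips e k U X -> p \subset U -> q \subset U -> [disjoint p & q] ->
    (#|p| + #|q|)%N = e.+2 -> (#|q| <= k)%N -> flip X Y p q -> flips e k U Y.

Section LinkBound.

Variables (F : fieldType) (e k : nat) (T : finType) (U : {set T}).
Hypothesis ke : (k <= e)%N.
Implicit Types (X Y : {set {set T}}) (W p q : {set T}).

Local Notation trunc_chi := (trunc_chi F).

Lemma flips_minimal_cycles X : flips e k U X -> minimal_cycles e X.
Proof.
elim=> [|{}X Y p q _ minX _ _ dpq pq _ flXY]; last exact: flip_minimal_cycles flXY _ _.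
by split=> [a b|a|a u chain _ [b /chain[]]]; rewrite inE.
Qed.

Lemma flips_down_closed X : flips e k U X -> down_closed X.
Proof. by case/flips_minimal_cycles. Qed.

(** The flips of p to q change only the coefficients #|q| <= k and
    #|p| >= e + 2 - k. *)
Lemma flips_coef_eq0 X j : flips e k U X -> (k < j)%N -> (j + k <= e.+1)%N ->
  (gpoly e.+2 X)`_j = 0.
Proof.
move=> flX kj je; elim: flX => [|{}X Y p q _ IH _ _ dpq pq qk flXY].
  by rewrite gpoly_set0 coef0.
rewrite (gpoly_flip flXY dpq pq) coefB coefD IH !coefXn.
have /negbTE -> : j != #|q| by apply/eqP; lia.
by have /negbTE -> : j != #|p| by apply/eqP; lia.
Qed.

Lemma induced_set0 W : induced (set0 : {set {set T}}) W = set0.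
Proof. by apply/setP=> a; rewrite !inE. Qed.

(** By trunc_chiS this is the vanishing of reduced homology at size n + 1.  It
    holds for the void complex, and the jumps of a flip at n and at n + 1 are
    opposite since no q has size n + 1 or n + 2. *)
Lemma flips_trunc_chi_alternate X W n : flips e k U X -> (k <= n)%N -> (n.+1 + k <= e)%N ->
  trunc_chi (induced X W) n.+1 + trunc_chi (induced X W) n = 0.
Proof.
move=> flX kn ne; elim: flX => [|{}X Y p q flX IH pU qU dpq pq qk flXY].
  by rewrite induced_set0 !trunc_chi_set0.
have clX := flips_down_closed flX.
have clY := flips_down_closed (flips_step flX pU qU dpq pq qk flXY).
rewrite !(trunc_chi_flip_eq F W clX clY flXY); try by [lia | apply/eqP; lia].
rewrite addrACA IH add0r /flip_jump; have qn : (#|q| <= n)%N by lia.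
rewrite qn (leqW qn) subSn //; case: ifP => _; rewrite ?addr0 // exprS; ring.
Qed.

(** The value of the averaged truncated Euler characteristic that the g-vector
    predicts. *)
Definition weighted_g X n : rat :=
  \sum_(0 <= j < n.+1) (-1) ^+ (n - j) * beta_int j (e.+2 - j) * ((gpoly e.+2 X)`_j)%:~R.

Lemma weighted_g_flip X Y p q n : flip X Y p q -> [disjoint p & q] ->
  (#|p| + #|q|)%N = e.+2 -> (n < #|p|)%N ->
  weighted_g Y n = weighted_g X n
    + (if (#|q| <= n)%N then (-1) ^+ (n - #|q|) * beta_int #|q| #|p| else 0).
Proof.
move=> flXY dpq pq np; pose f j := (-1) ^+ (n - j) * beta_int j (e.+2 - j).
have -> : (if (#|q| <= n)%N then (-1) ^+ (n - #|q|) * beta_int #|q| #|p| else 0)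
    = \sum_(0 <= j < n.+1) f j * (j == #|q|)%:R.
  case: ifP => qn.
    rewrite (bigD1_seq #|q|) ?iota_uniq ?mem_index_iota //= eqxx mulr1 big1 ?addr0.
      by rewrite /f -pq addnK.
    by move=> j /negbTE ->; rewrite mulr0.
  rewrite big_nat big1 // => j /andP[_ jn]; case: eqP => [jq|]; last by rewrite mulr0.
  by rewrite -jq -ltnS jn in qn.
rewrite /weighted_g -big_split; apply: eq_big_nat => j /andP[_ jn] /=.
rewrite (gpoly_flip flXY dpq pq) coefB coefD !coefXn.
have /negbTE -> : j != #|p| by apply/eqP; lia.
by rewrite subr0 rmorphD mulrDr rmorph_nat.
Qed.

(** Both sides start at 0 for the void complex, and a flip adds to the left side
    at most the average of its jump, which is what it adds to the right side. *)
Lemma flips_average_le X n : flips e k U X -> (n + k <= e)%N ->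
  average U (fun W => (trunc_chi (induced X W) n)%:~R) <= weighted_g X n.
Proof.
move=> flX ne; elim: flX => [|{}X Y p q flX IH pU qU dpq pq qk flXY].
  rewrite /average big1 => [|W _]; last by rewrite induced_set0 trunc_chi_set0 mulr0.
  by rewrite /weighted_g big1 // => j _; rewrite gpoly_set0 coef0 mulr0.
have clX := flips_down_closed flX.
have clY := flips_down_closed (flips_step flX pU qU dpq pq qk flXY).
have np : (n.+1 < #|p|)%N by lia.
rewrite (weighted_g_flip flXY) ?(ltnW np) // -(average_flip_jump n pU qU dpq).
apply: le_trans (lerD IH (lexx _)); rewrite -averageD; apply: le_average => W _.
by rewrite -rmorphD ler_int trunc_chi_flip_le.
Qed.

Lemma flips_average_eq X n : flips e k U X -> (k <= n)%N -> (n + k <= e)%N ->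
  average U (fun W => (trunc_chi (induced X W) n)%:~R) = weighted_g X n.
Proof.
move=> flX kn ne; elim: flX => [|{}X Y p q flX IH pU qU dpq pq qk flXY].
  rewrite /average big1 => [|W _]; last by rewrite induced_set0 trunc_chi_set0 mulr0.
  by rewrite /weighted_g big1 // => j _; rewrite gpoly_set0 coef0 mulr0.
have clX := flips_down_closed flX.
have clY := flips_down_closed (flips_step flX pU qU dpq pq qk flXY).
have np : (n.+1 < #|p|)%N by lia.
rewrite (weighted_g_flip flXY) ?(ltnW np) // -(average_flip_jump n pU qU dpq) -IH.
rewrite -averageD; apply: eq_average => W _.
by rewrite -rmorphD (trunc_chi_flip_eq F W clX clY flXY) //; apply/eqP; lia.
Qed.

End LinkBound.

(** * Stellated spheres are obtained by flips in a fixed vertex set *)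

Definition image_cx (T T0 : finType) (f : T -> T0) (X : {set {set T}}) :
    {set {set T0}} :=
  [set f @: (a : {set T}) | a in X].

Lemma vertices_sub (T : finType) (X : {set {set T}}) (a : {set T}) :
  down_closed X -> a \in X -> a \subset vertices X.
Proof.
by move=> clX aX; apply/subsetP=> x xa; rewrite inE (clX _ _ aX) // sub1set.
Qed.

Lemma in_join_simplex_bd (T : finType) (p q a : {set T}) : [disjoint p & q] ->
  (a \in join (simplex p) (simplex_bd q)) = (a \subset p :|: q) && ~~ (q \subset a).
Proof.
move=> dpq; apply/imset2P/andP => [[b c]|[apq nqa]].
  rewrite !inE => bp /properP[cq [y yq yc]] ->; split; first exact: setUSS.
  apply/subsetPn; exists y => //; rewrite inE (negbTE yc) orbF.
  by apply: contraTN yq => /(subsetP bp) yp; rewrite (disjointFr dpq).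
exists (a :&: p) (a :&: q); rewrite ?inE ?subsetIr //.
  by rewrite properE subsetIr subsetI subxx andbT.
by rewrite -setIUr; apply/esym/setIidPl.
Qed.

Lemma in_join_bd_simplex (T : finType) (p q a : {set T}) : [disjoint p & q] ->
  (a \in join (simplex_bd p) (simplex q)) = (a \subset p :|: q) && ~~ (p \subset a).
Proof.
move=> dpq; rewrite setUC -in_join_simplex_bd 1?disjoint_sym //.
by apply/imset2P/imset2P=> -[b c bX cX ->]; exists c b; rewrite // setUC.
Qed.

Lemma bistellar_flip (T : finType) (d : int) (X : {set {set T}}) (p q : {set T}) :
  bistellar_admissible d X p q -> flip X (bistellar_move X p q) p q.
Proof.
case=> _ [p0 q0 dpq] _ /setP ind.
have inX (a : {set T}) : a \subset p :|: q -> (a \in X) = ~~ (q \subset a).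
  by move=> apq; have := ind a; rewrite in_join_simplex_bd // inE apq andbT.
have inY (a : {set T}) : (a \in bistellar_move X p q)
    = if a \subset p :|: q then ~~ (p \subset a) else a \in X.
  rewrite inE in_setD in_join_simplex_bd // in_join_bd_simplex //.
  by case: ifP => [/inX ->|_] /=; rewrite ?orbF // andNb.
split=> a ha; last by rewrite inY (negbTE ha).
by split; rewrite ?inY ?ha // inX.
Qed.

Lemma imset_subset_inj (T T0 : finType) (f : T -> T0) (V a b : {set T}) :
  {in V &, injective f} -> a \subset V -> b \subset V ->
  (f @: a \subset f @: b) = (a \subset b).
Proof.
move=> injf aV bV; apply/idP/idP => [/subsetP fab|]; last exact: imsetS.
apply/subsetP=> x xa; have /imsetP[y yb /injf xy] := fab _ (imset_f f xa).
by rewrite (xy (subsetP aV _ xa) (subsetP bV _ yb)).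
Qed.

Lemma flip_image (T T0 : finType) (f : T -> T0) (X Y : {set {set T}}) (V p q : {set T}) :
  {in V &, injective f} -> (forall a, a \in X -> a \subset V) ->
  (forall a, a \in Y -> a \subset V) -> p :|: q \subset V -> flip X Y p q ->
  flip (image_cx f X) (image_cx f Y) (f @: p) (f @: q).
Proof.
move=> injf XV YV sV [h1 h2].
have image_in (Z : {set {set T}}) (a : {set T}) : (forall b, b \in Z -> b \subset V) ->
    a \subset V -> (f @: a \in image_cx f Z) = (a \in Z).
  move=> ZV aV; apply/imsetP/idP => [[b bZ /eqP]|aZ]; last by exists a.
  have bV := ZV _ bZ; rewrite eqEsubset !(imset_subset_inj injf) // => /andP[ab ba].
  by rewrite (_ : a = b) //; apply/eqP; rewrite eqEsubset ab.
split=> a'; rewrite -imsetU => ha.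
  pose a := (p :|: q) :&: f @^-1: a'.
  have ->: a' = f @: a.
    apply/setP=> z; apply/idP/imsetP => [za|[x]]; last by rewrite !inE => /andP[_ xa] ->.
    have /imsetP[x xs zE] := subsetP ha _ za.
    by exists x; rewrite // in_setI xs inE -zE.
  have als : a \subset p :|: q by apply: subsetIl.
  have aV := subset_trans als sV; have := sV; rewrite subUset => /andP[pV qV].
  by rewrite !image_in // !(imset_subset_inj injf) // !h1.
by apply/imsetP/imsetP => -[b bZ E]; exists b => //; [rewrite -h2 | rewrite h2] => //;
  apply: contra ha; rewrite E; apply: imsetS.
Qed.

(** The stellated spheres live over varying vertex types and are transported
    along maps that are injective on vertices.  Since k <= e, the face p of a
    move has at least two points, so no move removes a vertex; an embedding of
    the vertices of the last complex therefore embeds all the earlier ones. *)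
Lemma stellated_flips (k e : nat) (d : int) (T : finType) (X : {set {set T}}) :
  (k <= e)%N -> d = e%:Z -> stellated k d X ->
  forall (T0 : finType) (f : T -> T0) (U : {set T0}),
    {in vertices X &, injective f} -> f @: vertices X \subset U ->
  flips e k U (image_cx f X).
Proof.
move=> ke dE.
elim=> {T X} [T c cc|T X p q _ IH adm qk|T T' X X' _ IH [g [injg ->]]]
  T0 f U injf fU.
- have c2 : #|c| = e.+2 by lia.
  have vc : vertices (simplex_bd c) = c.
    apply/setP=> x; rewrite !inE properEcard sub1set cards1 c2.
    by case: (x \in c).
  rewrite vc in injf fU.
  apply: (@flips_step e k T0 U set0 _ (f @: c) set0) => //; first exact: flips_void.
  + exact: sub0set.
  + by rewrite -setI_eq0 setI0.
  + by rewrite cards0 addn0 card_in_imset.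
  + by rewrite cards0.
  split=> a; rewrite setU0 => ha; rewrite !inE ?sub0set; last first.
    apply/esym/imsetP => -[b]; rewrite inE => /proper_sub bc aE.
    by rewrite aE imsetS in ha.
  split=> //; apply/imsetP/idP => [[b]|nca].
    rewrite inE => bc ->; have [bsc [x xc xb]] := properP bc.
    apply/subsetPn; exists (f x); first exact: imset_f.
    apply: contra xb => /imsetP[y yb /injf -> //]; exact: (subsetP bsc).
  exists (c :&: f @^-1: a); last first.
    apply/setP=> z; apply/idP/imsetP => [za|[x]]; last by rewrite !inE => /andP[_ xa] ->.
    by have /imsetP[x xc zE] := subsetP ha _ za; exists x; rewrite // !inE xc -zE.
  rewrite inE properE subsetIl /=; apply: contra nca => /subsetP cs.
  by apply/subsetP=> _ /imsetP[x /cs + ->]; rewrite !inE => /andP[].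
- have flXY := bistellar_flip adm.
  have [_ [p0 q0 dpq] dims _] := adm; set Y := bistellar_move X p q in flXY injf fU *.
  have pq : (#|p| + #|q|)%N = e.+2 by move: dims; rewrite /face_dim; lia.
  have {}qk : (#|q| <= k)%N by move: qk; rewrite /face_dim; lia.
  (* The identity embedding shows that X and Y are complexes. *)
  have flX : flips e k [set: T] X.
    rewrite (_ : X = image_cx id X); last first.
      by rewrite /image_cx -[LHS]imset_id; apply: eq_imset => a; rewrite imset_id.
    by apply: IH => //; apply: subsetT.
  have clX := flips_down_closed flX.
  have clY : down_closed Y.
    by apply: flips_down_closed (flips_step flX _ _ dpq pq qk flXY); apply: subsetT.
  have VXY : vertices X \subset vertices Y.
    apply/subsetP=> x; rewrite inE => xX; rewrite inE.
    have [xs|nxs] := boolP ([set x] \subset p :|: q); last by rewrite -(flXY.2 _ nxs).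
    rewrite (flXY.1 _ xs).2; apply/negP=> /subset_leq_card; rewrite cards1; lia.
  have sV : p :|: q \subset vertices Y.
    apply/subsetP=> x xs; rewrite inE (flXY.1 _ _).2 ?sub1set //.
    by apply/negP=> /subset_leq_card; rewrite cards1; lia.
  have [pV qV] : p \subset vertices Y /\ q \subset vertices Y.
    by apply/andP; rewrite -subUset.
  apply: (@flips_step e k T0 U (image_cx f X) _ (f @: p) (f @: q)).
  + apply: IH; last exact: subset_trans (imsetS _ VXY) fU.
    by move=> x y /(subsetP VXY) xY /(subsetP VXY) yY; apply: injf.
  + exact: subset_trans (imsetS _ pV) fU.
  + exact: subset_trans (imsetS _ qV) fU.
  + rewrite -setI_eq0; apply/eqP/setP=> z; rewrite !inE.
    apply/negP=> /andP[/imsetP[x xp ->]].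
    case/imsetP=> y yq /(injf _ _ (subsetP pV _ xp) (subsetP qV _ yq)) E.
    by have := disjointFr dpq xp; rewrite E yq.
  + rewrite !card_in_imset // => x y.
    * by move=> /(subsetP qV) xY /(subsetP qV) yY; apply: injf.
    * by move=> /(subsetP pV) xY /(subsetP pV) yY; apply: injf.
  + by apply: leq_trans (leq_imset_card _ _) qk.
  + apply: flip_image injf _ _ sV flXY => a aX; last exact: vertices_sub.
    by apply: subset_trans VXY; apply: vertices_sub.
- have comp : image_cx f (image_cx g X) = image_cx (f \o g) X.
    rewrite /image_cx -imset_comp; apply: eq_imset => a /=; by rewrite imset_comp.
  have gV x : x \in vertices X -> g x \in vertices (image_cx g X).
    rewrite !inE => xX; rewrite -imset_set1; exact: imset_f.
  rewrite -/(image_cx g X) comp; apply: IH.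
    by move=> x y xX yX /injf E; apply: injg; rewrite // E ?gV.
  apply: subset_trans fU; rewrite imset_comp; apply: imsetS.
  by apply/subsetP=> _ /imsetP[x xX ->]; apply: gV.
Qed.

(** * Betti numbers of a complex and of its vertex links *)

Section Betti.

Variables (T : finType) (F : fieldType).
Implicit Types (X : {set {set T}}) (W : {set T}) (x : T).

Local Notation trunc_chi := (trunc_chi F).

Lemma rank_boundary_mx X i : (0 < i)%N -> \rank (boundary_mx F X i) = rk F X i.+1.
Proof.
move=> i0; pose s := select F (faces X i.+1); pose t := select F (faces X i).
have bE : boundary_mx F X i = s *m bd F X i.+1 *m t^T.
  have -> : s *m bd F X i.+1 *m t^T = (t *m (s *m bd F X i.+1)^T)^T.
    by rewrite trmx_mul trmxK.
  apply/matrixP=> r c; rewrite [RHS]mxE /t select_mul [RHS]mxE /s select_mul.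
  rewrite !mxE !enum_rankK (gtn_eqF i0).
  have := enum_valP r; have := enum_valP c; rewrite !in_faces.
  by move=> /andP[-> _] /andP[-> ->].
apply/eqP; rewrite eqn_leq; apply/andP; split.
  rewrite bE; exact: leq_trans (mxrankM_maxl _ _) (mxrankM_maxr _ _).
have -> : rk F X i.+1 = \rank (s^T *m boundary_mx F X i *m t).
  rewrite bE !mulmxA tr_select -!mulmxA tr_select mulmxA keep_bd //.
  rewrite mul_keep_r; congr (\rank _); apply: eq_set_mx => a b; rewrite in_faces.
  case: and3P => [[aX ai bX]|]; last by rewrite if_same.
  have [->|nz] := eqVneq (incidence F a b) 0; first by rewrite if_same.
  by rewrite bX (inc_size nz ai).
exact: leq_trans (mxrankM_maxl _ _) (mxrankM_maxr _ _).
Qed.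

Lemma bettiE X i : (0 < i)%N ->
  betti F X i = (#|faces X i.+1| - rk F X i.+1 - rk F X i.+2)%N.
Proof. by move=> i0; rewrite /betti mxrank_ker !rank_boundary_mx. Qed.

Lemma rk_closed_le X n : down_closed X -> (rk F X n + rk F X n.+1 <= #|faces X n|)%N.
Proof.
move=> clX; apply: (@rk_pair_le T F X set0) => //.
- by move=> a b; rewrite inE.
- by rewrite set0U.
- by rewrite -setI_eq0 set0I.
Qed.

Lemma betti_trunc_chi X i : down_closed X -> (0 < i)%N ->
  (betti F X i)%:Z = trunc_chi X i.+1 + trunc_chi X i.
Proof.
move=> clX i0; rewrite bettiE // trunc_chiS.
have := rk_closed_le i.+1 clX; lia.
Qed.

(** The relative chains of the pair (X[x |: W], X[W]) are those of a cone over
    the restricted link of x. *)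
Lemma trunc_chi_induced_add X x W n : down_closed X -> x \notin W ->
  trunc_chi (induced X (x |: W)) n.+1
    <= trunc_chi (induced X W) n.+1 + trunc_chi (induced (link X x) W) n.
Proof.
move=> clX xW; have [E dis] := induced_add clX xW.
rewrite -(trunc_chi_cone F n (@link_notin T X x W)); apply: trunc_chi_subadd E dis;
  exact: down_closed_induced.
Qed.

Lemma trunc_chi_induced_add_eq X x W n : down_closed X -> x \notin W ->
  trunc_chi (induced (link X x) W) n.+1 + trunc_chi (induced (link X x) W) n = 0 ->
  trunc_chi (induced X (x |: W)) n.+1
    = trunc_chi (induced X W) n.+1 + trunc_chi (induced (link X x) W) n.
Proof.
move=> clX xW lk0; have [E dis] := induced_add clX xW.
rewrite -(trunc_chi_cone F n (@link_notin T X x W)); apply: trunc_chi_additive E dis _;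
  try exact: down_closed_induced.
rewrite card_faces_cone ?rk_cone; try exact: link_notin.
move: lk0; rewrite trunc_chiS; lia.
Qed.

(** Reduced homology of X at size n + 2 can only be created by a vertex whose
    restricted link has reduced homology at size n + 1. *)
Lemma acyclic_induced X n : down_closed X ->
  (forall x W, trunc_chi (induced (link X x) W) n.+1
    + trunc_chi (induced (link X x) W) n = 0) ->
  (#|faces X n.+2| <= rk F X n.+2 + rk F X n.+3)%N.
Proof.
move=> clX lk0; suff ind (W : {set T}) : (#|faces (induced X W) n.+2|
    <= rk F (induced X W) n.+2 + rk F (induced X W) n.+3)%N.
  have := ind setT; rewrite (_ : induced X setT = X) //.
  by apply/setP=> a; rewrite inE subsetT andbT.
move: {2}#|W| (erefl #|W|) => m; elim: m W => [|m IH] W Wm.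
  rewrite (_ : faces _ _ = set0) ?cards0 //; apply/setP=> a; rewrite !inE.
  apply/negP=> /andP[/andP[_ /subset_leq_card]]; rewrite Wm; lia.
have /card_gt0P[x xW] : (0 < #|W|)%N by rewrite Wm.
have [E dis] := induced_add clX (negbT (setD11 x W)).
have {E dis} [clZ clV E dis] :
  [/\ down_closed (induced X W), down_closed (induced X (W :\ x)),
   induced X W = induced X (W :\ x) :|: cone x (induced (link X x) (W :\ x))
   & [disjoint induced X (W :\ x) & cone x (induced (link X x) (W :\ x))]].
  by split=> //; try exact: down_closed_induced; rewrite -{1}(setD1K xW).
rewrite (card_faces_pair E dis) card_faces_cone; last exact: link_notin.
have := rk_superadd F clV E dis n.+2; have := rk_superadd F clV E dis n.+3.
rewrite !rk_cone; try exact: link_notin.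
have := IH (W :\ x); rewrite (cardsD1 x) xW in Wm.
have := lk0 x (W :\ x); rewrite trunc_chiS; lia.
Qed.

End Betti.

Section TwoNeighbourly.

Variables (T : finType) (F : fieldType) (M : {set {set T}}) (v : T).
Hypotheses (clM : down_closed M) (M0 : set0 \in M).
Hypotheses (neighM : two_neighbourly M) (vM : v \in vertices M).

Local Notation trunc_chi := (trunc_chi F).

(** The reduced Betti numbers at sizes 0 and 1 vanish: the edges at v give the
    rank that connectedness requires. *)
Lemma trunc_chi1 : trunc_chi M 1 = 0.
Proof.
have := trunc_chiS F M 0; rewrite trunc_chi0.
have f0 : #|faces M 0| = 1%N.
  rewrite (_ : faces M 0 = [set set0]) ?cards1 //; apply/setP=> a; rewrite !inE cards_eq0.
  by case: eqP => [->|]; rewrite ?M0 ?andbF.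
have := rk_closed_le F 1 clM; have := rk_closed_le F 0 clM; rewrite f0 rk0.
have r1 : (0 < rk F M 1)%N.
  apply: leq_trans (rk_matching F M v 1); apply/card_gt0P; exists [set v].
  by move: vM; rewrite !inE cards1 eqxx => ->; rewrite setDv M0 eqxx.
have r2 : (#|faces M 1|.-1 <= rk F M 2)%N.
  apply: leq_trans (rk_matching F M v 2).
  have -> : #|faces M 1|.-1 = #|faces M 1 :\ [set v]|.
    rewrite [in LHS](cardsD1 [set v]) inE cards1 eqxx andbT.
    by move: vM; rewrite inE => ->.
  rewrite -(card_in_imset (f := setU [set v])).
    apply: subset_leq_card; apply/subsetP=> _ /imsetP[a + ->].
    rewrite !inE => /and3P[nav aM /cards1P[x ax]]; rewrite ax in nav aM *.
    have nvx : v != x by apply: contraNneq nav => ->.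
    rewrite eqxx cardsU1 inE nvx cards1 setU1K ?inE // aM !andbT.
    by apply: neighM; rewrite // inE.
  move=> a b; rewrite !inE => /and3P[nav _ /cards1P[x ax]] /and3P[nbv _ /cards1P[y bx]].
  rewrite ax bx in nav nbv * => E.
  have nvx : v \notin [set x] by rewrite inE; apply: contraNneq nav => ->.
  have nvy : v \notin [set y] by rewrite inE; apply: contraNneq nbv => ->.
  by rewrite -(setU1K nvx) -(setU1K nvy) E.
lia.
Qed.

Lemma trunc_chi_betti l :
  \sum_(1 <= i < l.+1) (-1) ^+ (l - i) * (betti F M i)%:Z = trunc_chi M l.+1.
Proof.
elim: l => [|l IH]; first by rewrite big_geq // trunc_chi1.
rewrite big_nat_recr //= subnn expr0 mul1r betti_trunc_chi //.
rewrite [X in X + _](_ : _ = - trunc_chi M l.+1); first by ring.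
rewrite -IH -sumrN; apply: eq_big_nat => i /andP[_ il].
by rewrite subSn // exprS mulN1r mulNr.
Qed.

End TwoNeighbourly.

Definition inv_bin n j : rat := ('C(n, j)%:R)^-1.

Lemma beta_int_inv_bin d j : (j <= d)%N ->
  j.+1%:R * beta_int j (d.+1 - j) = inv_bin d.+2 j.+1.
Proof.
move=> jd; rewrite /inv_bin /beta_int subnKC ?leqW //; have := @bin_fact d.+2 j.+1.
rewrite subSS factS => /(_ (leqW jd)) /(congr1 (fun n => n%:R : rat)) <-.
rewrite !natrM; have := fact_neq0 j; have := fact_neq0 (d.+1 - j).
move: j`!%:R (d.+1 - j)`!%:R => u v v0 u0.
have j0 : j.+1%:R != 0 :> rat by rewrite pnatr_eq0.
have b0 : 'C(d.+2, j.+1)%:R != 0 :> rat by rewrite pnatr_eq0 -lt0n bin_gt0; lia.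
move: j.+1%:R 'C(d.+2, j.+1)%:R j0 b0 => w z w0 z0.
by field; rewrite u0 v0 w0 z0.
Qed.

Lemma beta_int_inv_bin_sub d j : (j <= d)%N ->
  (d.+2 - j)%:R * beta_int j (d.+1 - j) = inv_bin d.+2 j.
Proof.
move=> jd; rewrite /inv_bin /beta_int subnKC ?leqW //; have := @bin_fact d.+2 j.
have -> : (d.+2 - j = (d.+1 - j).+1)%N by lia.
rewrite factS => /(_ ltac:(lia)) /(congr1 (fun n => n%:R : rat)) <-.
rewrite !natrM; have := fact_neq0 j; have := fact_neq0 (d.+1 - j).
move: j`!%:R (d.+1 - j)`!%:R => u v v0 u0.
have j0 : (d.+1 - j).+1%:R != 0 :> rat by rewrite pnatr_eq0.
have b0 : 'C(d.+2, j)%:R != 0 :> rat by rewrite pnatr_eq0 -lt0n bin_gt0; lia.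
move: (d.+1 - j).+1%:R 'C(d.+2, j)%:R j0 b0 => w z w0 z0.
by field; rewrite u0 v0 w0 z0.
Qed.

Lemma le_inv_bin n j (u w : int) : (j <= n)%N ->
  (u%:~R <= inv_bin n j * w%:~R) = ('C(n, j)%:Z * u <= w).
Proof.
move=> jn; rewrite /inv_bin ler_pdivlMl ?ltr0n ?bin_gt0 //.
by rewrite pmulrn -intrM ler_int.
Qed.

Lemma eq_inv_bin n j (u w : int) : (j <= n)%N ->
  u%:~R = inv_bin n j * w%:~R -> w = 'C(n, j)%:Z * u.
Proof.
move=> jn uw; apply: (@intr_inj rat); rewrite intrM uw -pmulrn mulVKf //.
by rewrite pnatr_eq0 -lt0n bin_gt0.
Qed.

(** * Lower bounds for the g-vector *)

Section Main.

Variables (T : finType) (F : fieldType) (e k : nat) (M : {set {set T}}).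
Hypotheses (ke : (k <= e)%N) (clM : down_closed M).
Hypothesis dimM : forall a, a \in M -> (#|a| <= e.+2)%N.
Hypothesis links : forall x, flips e k [set~ x] (link M x).
Hypothesis M0 : set0 \in M.

Local Notation trunc_chi := (trunc_chi F).
Local Notation g j := ((gpoly e.+3 M)`_j).

(** The relation between the g-vectors of M and of its links, in the
    normalization in which its alternating sums telescope. *)
Lemma sum_link_coef j : (j <= e.+1)%N ->
  beta_int j (e.+2 - j) * (\sum_x (gpoly e.+2 (link M x))`_j)%:~R
    = inv_bin e.+3 j.+1 * (g j.+1)%:~R + inv_bin e.+3 j * (g j)%:~R.
Proof.
move=> je; rewrite coef_sum_link //; last by move=> a /dimM /leqW.
rewrite -beta_int_inv_bin // -beta_int_inv_bin_sub //.
have -> : e.+3%:Z - j%:Z = (e.+3 - j)%N%:Z by lia.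
rewrite rmorphD !rmorphM /= -!pmulrn; ring.
Qed.

Lemma gpoly_coef0 : g 0 = 1.
Proof.
rewrite coef_gpoly /g_vector big_nat1 subnn expr0 mul1r bin0 mul1r.
rewrite (_ : faces M 0 = [set set0]) ?cards1 //; apply/setP=> a; rewrite !inE cards_eq0.
by case: eqP => [->|]; rewrite ?M0 ?andbF.
Qed.

Lemma sum_weighted_g n : (n <= e.+1)%N ->
  \sum_x weighted_g e (link M x) n = inv_bin e.+3 n.+1 * (g n.+1)%:~R + (-1) ^+ n.
Proof.
have -> : \sum_x weighted_g e (link M x) n
    = \sum_(0 <= j < n.+1) (-1) ^+ (n - j) * (beta_int j (e.+2 - j)
        * (\sum_x (gpoly e.+2 (link M x))`_j)%:~R).
  rewrite /weighted_g exchange_big /=; apply: eq_bigr => j _.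
  by rewrite rmorph_sum /= -mulr_sumr -[LHS]mulrA.
elim: n => [|n IH] ne.
  rewrite big_nat1 subnn expr0 mul1r sum_link_coef // gpoly_coef0 {2}/inv_bin bin0 invr1.
  by rewrite mulr1.
rewrite big_nat_recr //= subnn expr0 mul1r sum_link_coef //.
have -> : \sum_(0 <= i < n.+1) (-1) ^+ (n.+1 - i) * (beta_int i (e.+2 - i)
    * (\sum_x (gpoly e.+2 (link M x))`_i)%:~R)
  = - \sum_(0 <= i < n.+1) (-1) ^+ (n - i) * (beta_int i (e.+2 - i)
    * (\sum_x (gpoly e.+2 (link M x))`_i)%:~R).
  rewrite -sumrN; apply: eq_big_nat => i /andP[_ ni].
  by rewrite subSn // exprS mulN1r mulNr.
rewrite IH ?(ltnW ne) // exprS; ring.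
Qed.

Let phi n (W : {set T}) : rat := (trunc_chi (induced M W) n.+1)%:~R.

Let phi_diff n : \sum_x average [set~ x] (fun W => phi n (x |: W) - phi n W)
  = (trunc_chi M n.+1)%:~R + (-1) ^+ n.
Proof.
rewrite sum_average_diff /phi.
have -> : induced M setT = M by apply/setP=> a; rewrite inE subsetT andbT.
have -> : induced M set0 = interval set0 set0.
  apply/setP=> a; rewrite !inE sub0set subset0.
  by case: eqP => [->|]; rewrite ?M0 ?andbF.
rewrite trunc_chi_interval_eq cards0 subn0 rmorphXn rmorphN1 exprS; ring.
Qed.

Lemma g_lower_bound n : (n + k <= e)%N ->
  (trunc_chi M n.+1)%:~R <= inv_bin e.+3 n.+1 * (g n.+1)%:~R.
Proof.
move=> ne; rewrite -(lerD2r ((-1) ^+ n)) -phi_diff -sum_weighted_g; last by lia.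
apply: ler_sum => x _; apply: le_trans (flips_average_le F ke (links x) ne).
apply: le_average => W; rewrite subsetC sub1set inE => xW.
by rewrite /phi -rmorphB ler_int lerBlDl trunc_chi_induced_add.
Qed.

Lemma g_equality_low n : (k <= n)%N -> (n.+1 + k <= e)%N ->
  (trunc_chi M n.+1)%:~R = inv_bin e.+3 n.+1 * (g n.+1)%:~R.
Proof.
move=> kn ne; apply: (addIr ((-1) ^+ n)); rewrite -phi_diff -sum_weighted_g; last by lia.
apply: eq_bigr => x _; rewrite -(flips_average_eq F ke (links x) kn); last by lia.
apply: eq_average => W; rewrite subsetC sub1set inE => xW.
rewrite /phi -rmorphB trunc_chi_induced_add_eq // ?addrK; first by rewrite addrC addKr.
exact: (flips_trunc_chi_alternate F ke W (links x) kn ne).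
Qed.

(** The middle coefficients of the links vanish. *)
Lemma g_recursion j : (k < j)%N -> (j + k <= e.+1)%N ->
  inv_bin e.+3 j.+1 * (g j.+1)%:~R = - (inv_bin e.+3 j * (g j)%:~R).
Proof.
move=> kj je; apply/eqP; rewrite -addr_eq0 -sum_link_coef; last by lia.
by rewrite big1 ?mulr0 // => x _; apply: (flips_coef_eq0 ke (links x)).
Qed.

Lemma betti_vanish i : (k < i)%N -> (i + k <= e)%N -> betti F M i = 0%N.
Proof.
case: i => // i ki ie; rewrite bettiE //; apply/eqP; rewrite -subnDA subn_eq0.
apply: acyclic_induced => // x W; exact: (flips_trunc_chi_alternate F ke W (links x)).
Qed.

(** At n = k the links are acyclic at the size that matters.  For larger n both
    sides alternate in sign: the left one because a Betti number vanishes, the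
    right one by g_recursion. *)
Lemma g_equality n : (k <= n)%N -> (n + k <= e)%N -> (k.+1 + k <= e)%N ->
  (trunc_chi M n.+1)%:~R = inv_bin e.+3 n.+1 * (g n.+1)%:~R.
Proof.
move=> kn ne kke; elim: n kn ne => [|n IH] kn ne.
  by apply: g_equality_low => //; lia.
have [kn'|] := eqVneq k n.+1; first by apply: g_equality_low => //; lia.
move=> nk; have {}kn : (k <= n)%N by lia.
rewrite g_recursion; try lia.
rewrite -IH //; last by lia.
have := @betti_trunc_chi T F M n.+1 clM isT; rewrite betti_vanish; try lia.
by move/esym/eqP; rewrite addr_eq0 => /eqP ->; rewrite rmorphN.
Qed.

End Main.

Theorem theorem3p7 (k d : nat) (T : finType) (M : {set {set T}})
    (F : fieldType) :
  locally_stellated k d M -> two_neighbourly M ->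
  [/\ d = (2 * k)%N ->
      forall l : nat, (1 <= l <= k - 1)%N ->
        g_vector d M l.+1 >=
          'C(d + 2, l.+1)%:Z
            * \sum_(1 <= i < l.+1) (-1) ^+ (l - i) * (betti F M i)%:Z,
      (d >= 2 * k + 1)%N ->
      forall l : nat, (1 <= l <= k)%N ->
        g_vector d M l.+1 >=
          'C(d + 2, l.+1)%:Z
            * \sum_(1 <= i < l.+1) (-1) ^+ (l - i) * (betti F M i)%:Z,
      (d >= 2 * k + 2)%N ->
      forall l : nat, (k <= l <= d - k - 1)%N ->
        g_vector d M l.+1 =
          'C(d + 2, l.+1)%:Z
            * \sum_(1 <= i < l.+1) (-1) ^+ (l - i) * (betti F M i)%:Z
    & (d >= 2 * k + 2)%N ->
      forall i : nat, (k + 1 <= i <= d - k - 1)%N -> betti F M i = 0%N].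
Proof.
case=> kd [M0 cl] dimM _ lkM neighM.
have clM : down_closed M by [].
have [dk|kd1] : (d <= k)%N \/ (k < d)%N by case: (leqP d k); [left|right].
  by split; lia.
case: d kd1 kd dimM lkM => // e; rewrite ltnS => ke _ dimM lkM.
have max_size : (\max_(a in M) #|a|)%N = e.+2 by move: dimM; rewrite /Defs.dim; lia.
have size_le a : a \in M -> (#|a| <= e.+2)%N.
  by move=> aM; rewrite -max_size leq_bigmax_cond.
have [v vM] : exists v, v \in vertices M.
  apply/set0Pn; apply: contraTneq isT => V0; suff: (e.+2 <= 0)%N by [].
  rewrite -max_size; apply/bigmax_leqP => a aM.
  by rewrite leqn0 cards_eq0 -subset0 -V0 vertices_sub.
have links x : flips e k [set~ x] (link M x).
  have [xM|nxM] := boolP (x \in vertices M); last first.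
    rewrite (_ : link M x = set0); first exact: flips_void.
    apply/setP=> a; rewrite !inE; apply: contraNF nxM => /and3P[_ _ xa].
    by rewrite inE (clM _ _ xa) // subsetUl.
  have dE : e.+1%:Z - 1 = e%:Z by lia.
  have := stellated_flips ke dE (lkM x xM) (T0 := T) (f := id) (U := [set~ x]).
  have -> : image_cx id (link M x) = link M x.
    by rewrite /image_cx -[RHS]imset_id; apply: eq_imset => a; rewrite imset_id.
  apply; first by [].
  rewrite imset_id subsetC sub1set !inE.
  by rewrite eqxx andbF.
have bound l : (l + k <= e)%N -> 'C(e.+1 + 2, l.+1)%:Z
     * \sum_(1 <= i < l.+1) (-1) ^+ (l - i) * (betti F M i)%:Z <= g_vector e.+1 M l.+1.
  move=> le; rewrite (trunc_chi_betti F clM M0 neighM vM) addn2 -coef_gpoly -le_inv_bin.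
    exact: g_lower_bound le.
  by lia.
split=> [dk l lk|dk l lk|dk l lk|dk i ik].
- by apply: bound; lia.
- by apply: bound; lia.
- rewrite (trunc_chi_betti F clM M0 neighM vM) addn2 -coef_gpoly.
  by apply: eq_inv_bin; [lia | apply: (g_equality F ke clM size_le links M0); lia].
- by apply: (betti_vanish F ke clM links); lia.
Qed.
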